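(* Let $K$ be a (large enough) number field with ring of integers $R$. Let $G$ be a finite group and $M$ an abelian subgroup of $G$ of central type. Consider the twist $J$ in $KM\otimes KM$ afforded by a non-degenerate normalized $2$-cocycle $\omega:\widehat{M}\times\widehat{M}\to K^{\times}$. Fix a Lagrangian decomposition $\widehat{M}\simeq L\times\widehat{L}$. Suppose that $L$ (viewed as a subgroup of $M$) is contained in a normal abelian subgroup $N$ of $G$. Then $(KG)_J$ admits a Hopf order over $R$.
   Context: Hopf orders. Let $H$ be a finite-dimensional Hopf algebra over a field $K$ and $R$ a subring of $K$. A Hopf order of $H$ over $R$ is a finitely generated projective $R$-submodule $X$ of $H$ such that the natural map $X\otimes_R K\to H$ is an isomorphism and $1_H\in X$, $XX\subseteq X$, $\Delta(X)\subseteq X\otimes_R X$ (viewed inside $H\otimes_K H$), $\varepsilon(X)\subseteq R$, $S(X)\subseteq X$, where $\Delta,\varepsilon,S$ are the coproduct, counit and antipode of $H$. Twists. For a finite abelian group $M$ such that $KM$ splits, $\widehat{M}$ is the group of characters $M\to K^{\times}$, and for $\phi\in\widehat{M}$, $e_\phi=\frac{1}{|M|}\sum_{m\in M}\phi(m^{-1})m\in KM$. The twist afforded by a normalized $2$-cocycle $\omega:\widehat{M}\times\widehat{M}\to K^\times$ (trivial action) is $J=\sum_{\phi,\psi\in\widehat{M}}\omega(\phi,\psi)e_\phi\otimes e_\psi$. If $M\le G$, then $(KG)_J$ is the Hopf algebra equal to $KG$ as an algebra, with the same counit, coproduct $\Delta_J(h)=J\Delta(h)J^{-1}$ and antipode $S_J(h)=U_JS(h)U_J^{-1}$,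 where $U_J=\sum_{\phi}\omega(\phi,\phi^{-1})e_\phi$ and $\Delta, S$ are those of the group algebra. Non-degeneracy. $\mathcal{B}_\omega(\phi,\psi)=\omega(\phi,\psi)\omega(\psi,\phi)^{-1}$ is the skew-symmetric pairing of $\omega$; $\omega$ is non-degenerate if $\mathcal{B}_\omega$ is. $M$ is of central type if $M\simeq E\times E$ for some abelian group $E$ (equivalently, $M$ admits a non-degenerate $2$-cocycle). Lagrangian decomposition. A subgroup $L\le\widehat{M}$ is Lagrangian if $L=L^{\perp}$ with respect to $\mathcal{B}_\omega$; then there is a short exact sequence $1\to L\to\widehat{M}\stackrel{\pi}{\to}\widehat{L}\to1$ with $\pi(m)(l)=\mathcal{B}_\omega(m,l)$. A Lagrangian decomposition is an isomorphism $\widehat{M}\simeq L\times\widehat{L}$ given by a splitting of $\pi$, such that, writing elements as pairs $(l,\lambda)$ with $l\in L$, $\lambda\in\widehat{L}$, one has $\mathcal{B}_\omega((l,\lambda),(l',\lambda'))=\lambda(l')\lambda'(l)^{-1}$. Identifying $M$ with the character group of $\widehat{M}$, and $L$ with that of $\widehat{L}$, one gets $M\simeq\widehat{L}\times L$, where the evaluation of $(l,\lambda)\in\widehat{M}$ at $(\lambda',l')\in M$ is $\lambda'(l)\lambda(l')$. In this way $L$ and $\widehat{L}$ are viewed as subgroups of $M$. ''Large enough'' means: $KM$ and $KN$ split as algebras (are isomorphic to products of copies of $K$), and $\omega$ equals, up to the coboundary of a $K^\times$-valued $1$-cochain on $\widehat{M}$, the $2$-cocycle $((l,\lambda),(l',\lambda'))\mapsto\lambda(l')$.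 (These conditions always hold after a finite extension of $K$.) *)

(* Defs.v *)
From HB Require Import structures.
From mathcomp Require Import all_boot all_order all_fingroup all_algebra all_solvable all_field.
From Stdlib Require ClassicalEpsilon.

Set Implicit Arguments.
Unset Strict Implicit.
Unset Printing Implicit Defensive.

Import GRing.Theory.
Local Open Scope ring_scope.

(** * Tensor products of finite-dimensional vector spaces and algebras *)

(* U ⊗ V in the coordinates given by the library bases vbasis {:U} and
   vbasis {:V}: the entry (i, j) is the coefficient of e_i ⊗ f_j.  The map
   tlift f is the linear map induced by a bilinear f (see tlift_pure). *)
Definition tens (K : fieldType) (U V : vectType K) : Type :=
  'M[K]_(\dim {:U}, \dim {:V}).

HB.instance Definition _ (K : fieldType) (U V : vectType K) :=
  Vector.on (tens U V).

Definition vbase (K : fieldType) (U : vectType K) (i : 'I_(\dim {:U})) : U :=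
  (vbasis {:U})`_i.
Definition vcoord (K : fieldType) (U : vectType K) (i : 'I_(\dim {:U})) (u : U)
    : K :=
  coord (vbasis {:U}) i u.

Definition pure (K : fieldType) (U V : vectType K) (u : U) (v : V) :
    tens U V :=
  \matrix_(i, j) (vcoord i u * vcoord j v).

Notation "u ⊗ v" := (pure u v) (at level 40, left associativity) : ring_scope.

Definition tlift (K : fieldType) (U V W : vectType K) (f : U -> V -> W)
    (t : tens U V) : W :=
  \sum_i \sum_j t i j *: f (vbase i) (vbase j).

Section TensTheory.
Variables (K : fieldType) (U V W : vectType K).

Lemma pureDl (v : V) : {morph (fun u : U => u ⊗ v) : x y / x + y}.
Proof.
by move=> x y; apply/matrixP=> i j; rewrite !mxE /vcoord linearD mulrDl.
Qed.

Lemma pureDr (u : U) : {morph (fun v : V => u ⊗ v) : x y / x + y}.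
Proof.
by move=> x y; apply/matrixP=> i j; rewrite !mxE /vcoord linearD mulrDr.
Qed.

Lemma pureZl a (u : U) (v : V) : (a *: u) ⊗ v = a *: (u ⊗ v).
Proof. by apply/matrixP=> i j; rewrite !mxE /vcoord linearZ mulrA. Qed.

Lemma pureZr a (u : U) (v : V) : u ⊗ (a *: v) = a *: (u ⊗ v).
Proof. by apply/matrixP=> i j; rewrite !mxE /vcoord linearZ mulrCA. Qed.

Lemma vbase_sum (u : U) : u = \sum_i vcoord i u *: vbase i.
Proof. exact: coord_vbasis (memvf u). Qed.

Lemma pure_vbase i j : (@vbase K U i) ⊗ (@vbase K V j) = delta_mx i j.
Proof.
apply/matrixP=> k l; rewrite !mxE /vcoord /vbase.
rewrite !coord_free ?(basis_free (vbasisP _)) //.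
by rewrite -natrM mulnb (eq_sym i) (eq_sym j).
Qed.

Lemma tens_ind (P : tens U V -> Prop) :
  P 0 -> (forall s t, P s -> P t -> P (s + t)) -> (forall u v, P (u ⊗ v)) ->
  forall t, P t.
Proof.
move=> P0 PD Pp t; rewrite [t]matrix_sum_delta.
apply: (big_ind P) => // i _; apply: (big_ind P) => // j _.
by rewrite -pure_vbase -pureZl.
Qed.

Lemma tliftD (f : U -> V -> W) : {morph tlift f : s t / s + t}.
Proof.
move=> s t; rewrite /tlift -big_split; apply: eq_bigr => i _.
by rewrite -big_split; apply: eq_bigr => j _; rewrite mxE scalerDl.
Qed.

Lemma tliftZ (f : U -> V -> W) a t : tlift f (a *: t) = a *: tlift f t.
Proof.
rewrite /tlift scaler_sumr; apply: eq_bigr => i _.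
by rewrite scaler_sumr; apply: eq_bigr => j _; rewrite mxE scalerA.
Qed.

Lemma tlift0 (f : U -> V -> W) : tlift f 0 = 0.
Proof. by rewrite -(scale0r 0) tliftZ scale0r. Qed.

End TensTheory.

Lemma tlift_pure (K : fieldType) (U V W : vectType K) (f : U -> V -> W) :
  (forall v, linear (f^~ v)) -> (forall u, linear (f u)) ->
  forall u v, tlift f (u ⊗ v) = f u v.
Proof.
move=> fl fr u v.
pose fL v := GRing.isLinear.Build _ _ _ _ (f^~ v) (fl v).
pose FL v : {linear U -> W} := HB.pack (f^~ v) (fL v).
pose fR u := GRing.isLinear.Build _ _ _ _ (f u) (fr u).
pose FR u : {linear V -> W} := HB.pack (f u) (fR u).
transitivity (FL v u); last by [].
rewrite [in RHS](vbase_sum u) linear_sum /tlift; apply: eq_bigr => i _.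
rewrite linearZ /=; transitivity (vcoord i u *: FR (vbase i) v); last by [].
rewrite [in RHS](vbase_sum v) linear_sum scaler_sumr; apply: eq_bigr => j _.
by rewrite linearZ /= scalerA mxE.
Qed.

Lemma eq_tlift (K : fieldType) (U V W : vectType K) (f g : U -> V -> W) :
  f =2 g -> tlift f =1 tlift g.
Proof.
by move=> fg t; apply: eq_bigr => i _; apply: eq_bigr => j _; rewrite fg.
Qed.

Section TensAlg.
Variables (K : fieldType) (A B : falgType K).
Local Notation T := (tens A B).

Definition tens_one : T := 1 ⊗ 1.
(* the product with (a ⊗ b)(c ⊗ d) = ac ⊗ bd (see tmul_pure) *)
Definition tens_mul (s t : T) : T :=
  tlift (fun a b => tlift (fun c d => (a * c) ⊗ (b * d)) t) s.

Lemma tmulDl : left_distributive tens_mul +%R.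
Proof. by move=> x y z; rewrite /tens_mul tliftD. Qed.

Lemma tmulDr : right_distributive tens_mul +%R.
Proof.
move=> x y z; rewrite /tens_mul (eq_tlift (fun a b => tliftD _ y z)).
rewrite {1 3 5}/tlift -big_split; apply: eq_bigr => i _.
by rewrite -big_split; apply: eq_bigr => j _; rewrite scalerDr.
Qed.

Lemma tmulZl a s t : tens_mul (a *: s) t = a *: tens_mul s t.
Proof. exact: tliftZ. Qed.

Lemma tmulZr a s t : tens_mul s (a *: t) = a *: tens_mul s t.
Proof.
rewrite /tens_mul {1 3}/tlift scaler_sumr; apply: eq_bigr => i _.
rewrite scaler_sumr; apply: eq_bigr => j _.
by rewrite tliftZ !scalerA mulrC.
Qed.

Lemma tmul_pure a b c d : tens_mul (a ⊗ b) (c ⊗ d) = (a * c) ⊗ (b * d).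
Proof.
have E a' b' : tlift (fun c d => (a' * c) ⊗ (b' * d)) (c ⊗ d)
               = (a' * c) ⊗ (b' * d) :> T.
  by rewrite tlift_pure // => ? k x y;
    rewrite mulrDr ?pureDl ?pureDr -scalerAr ?pureZl ?pureZr.
rewrite /tens_mul (eq_tlift E) tlift_pure // => ? k x y.
  by rewrite mulrDl pureDl -scalerAl pureZl.
by rewrite mulrDl pureDr -scalerAl pureZr.
Qed.

Lemma tmul0t t : tens_mul 0 t = 0.
Proof. exact: tlift0. Qed.

Lemma tmult0 t : tens_mul t 0 = 0.
Proof. by have := tmulZr 0 t 0; rewrite !scale0r. Qed.

Lemma tmulA : associative tens_mul.
Proof.
move=> x y z; elim/tens_ind: x => [|x x' ex ex'|a b]; first by rewrite !tmul0t.
  by rewrite !tmulDl ex ex'.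
elim/tens_ind: y => [|y y' ey ey'|c d]; first by rewrite !(tmul0t, tmult0).
  by rewrite !(tmulDl, tmulDr) ey ey'.
elim/tens_ind: z => [|z z' ez ez'|e f]; first by rewrite !tmult0.
  by rewrite !tmulDr ez ez'.
by rewrite !tmul_pure !mulrA.
Qed.

Lemma tmul1t : left_id tens_one tens_mul.
Proof.
elim/tens_ind => [|x y ex ey|a b]; first by rewrite tmult0.
  by rewrite tmulDr ex ey.
by rewrite tmul_pure !mul1r.
Qed.

Lemma tmult1 : right_id tens_one tens_mul.
Proof.
elim/tens_ind => [|x y ex ey|a b]; first by rewrite tmul0t.
  by rewrite tmulDl ex ey.
by rewrite tmul_pure !mulr1.
Qed.

Lemma tens_one_neq0 : tens_one != 0.
Proof.
have nz (C : falgType K) : exists i, vcoord i (1 : C) != 0.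
  apply/existsP; apply: contraT; rewrite negb_exists => /forallP h.
  have := oner_neq0 C; rewrite [X in X != 0]vbase_sum big1 ?eqxx // => i _.
  by have := h i; rewrite negbK => /eqP ->; rewrite scale0r.
have [[i iP] [j jP]] := (nz A, nz B).
apply/eqP => /matrixP/(_ i j)/eqP.
by rewrite !mxE mulf_eq0 (negPf iP) (negPf jP).
Qed.

HB.instance Definition _ := GRing.Zmodule_isNzRing.Build (tens A B)
  tmulA tmul1t tmult1 tmulDl tmulDr tens_one_neq0.
HB.instance Definition _ := GRing.Lmodule_isLalgebra.Build K (tens A B)
  (fun a s t => esym (tmulZl a s t)).
HB.instance Definition _ := GRing.Lalgebra_isAlgebra.Build K (tens A B)
  (fun a s t => esym (tmulZr a s t)).
HB.instance Definition _ := Algebra_isFalgebra.Build K (tens A B).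

End TensAlg.

(** * Group algebras *)

Definition galg (K : fieldType) (gT : finGroupType) : Type :=
  {ffun gT -> K^o}.

HB.instance Definition _ (K : fieldType) (gT : finGroupType) :=
  Vector.on (galg K gT).

Section GroupAlgebra.
Variables (K : fieldType) (gT : finGroupType).
Local Notation A := (galg K gT).

Definition coeff (f : A) (x : gT) : K := (f : {ffun gT -> K^o}) x.
Definition galg_of (F : gT -> K) : A := [ffun x => F x : K^o].

Definition gelt (x : gT) : A := galg_of (fun y => (y == x)%:R).
Definition galg_mul (f g : A) : A :=
  galg_of (fun x => \sum_(y : gT) coeff f y * coeff g (y^-1 * x)%g).

Lemma coeffE F x : coeff (galg_of F) x = F x.
Proof. by rewrite /coeff ffunE. Qed.
Lemma galgP (f g : A) : coeff f =1 coeff g -> f = g.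
Proof. by move=> fg; apply/ffunP. Qed.
Lemma coeffD (f g : A) x : coeff (f + g) x = coeff f x + coeff g x.
Proof. by rewrite /coeff ffunE. Qed.
Lemma coeffZ a (f : A) x : coeff (a *: f) x = a * coeff f x.
Proof. by rewrite /coeff ffunE. Qed.

Lemma galg_mulA : associative galg_mul.
Proof.
move=> f g h; apply: galgP => x; rewrite !coeffE.
under [RHS]eq_bigr => y _ do rewrite coeffE mulr_suml.
rewrite exchange_big; apply: eq_bigr => z _ /=.
rewrite coeffE mulr_sumr [RHS](reindex_inj (mulgI z)); apply: eq_bigr => y _.
by rewrite mulrA mulKg invMg mulgA.
Qed.

Lemma galg_mul1 : left_id (gelt 1%g) galg_mul.
Proof.
move=> f; apply: galgP => x; rewrite !coeffE (bigD1 1%g) //= big1 => [|y yn1].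
  by rewrite coeffE eqxx mul1r invg1 mul1g addr0.
by rewrite coeffE (negPf yn1) mul0r.
Qed.

Lemma galg_mulr1 : right_id (gelt 1%g) galg_mul.
Proof.
move=> f; apply: galgP => x; rewrite !coeffE (bigD1 x) //= big1 => [|y ynx].
  by rewrite coeffE mulVg eqxx mulr1 addr0.
by rewrite coeffE -eq_mulVg1 (negPf ynx) mulr0.
Qed.

Lemma galg_mulDl : left_distributive galg_mul +%R.
Proof.
move=> f g h; apply: galgP => x; rewrite coeffD !coeffE -big_split.
by apply: eq_bigr => y _; rewrite coeffD mulrDl.
Qed.

Lemma galg_mulDr : right_distributive galg_mul +%R.
Proof.
move=> f g h; apply: galgP => x; rewrite coeffD !coeffE -big_split.
by apply: eq_bigr => y _; rewrite coeffD mulrDr.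
Qed.

Lemma galg_scaleAl a f g : a *: galg_mul f g = galg_mul (a *: f) g.
Proof.
apply: galgP => x; rewrite coeffZ !coeffE mulr_sumr.
by apply: eq_bigr => y _; rewrite coeffZ mulrA.
Qed.

Lemma galg_scaleAr a f g : a *: galg_mul f g = galg_mul f (a *: g).
Proof.
apply: galgP => x; rewrite coeffZ !coeffE mulr_sumr.
by apply: eq_bigr => y _; rewrite coeffZ mulrCA.
Qed.

Lemma galg_one_neq0 : gelt 1%g != 0.
Proof.
apply/eqP => /ffunP/(_ 1%g); rewrite !ffunE eqxx => /eqP.
by rewrite oner_eq0.
Qed.

HB.instance Definition _ := GRing.Zmodule_isNzRing.Build (galg K gT)
  galg_mulA galg_mul1 galg_mulr1 galg_mulDl galg_mulDr galg_one_neq0.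
HB.instance Definition _ :=
  GRing.Lmodule_isLalgebra.Build K (galg K gT) galg_scaleAl.
HB.instance Definition _ :=
  GRing.Lalgebra_isAlgebra.Build K (galg K gT) galg_scaleAr.
HB.instance Definition _ := Algebra_isFalgebra.Build K (galg K gT).

End GroupAlgebra.

Definition split_algebra (K : fieldType) (A : falgType K) : Prop :=
  exists (n : nat) (f : {lrmorphism A -> {ffun 'I_n -> K^o}}), bijective f.

(** * Character groups *)

Section LinearCharacters.
Variables (K : fieldType) (gT : finGroupType) (M : {group gT}).

(* A homomorphism M -> K^*, extended by 0 outside M so that equality of
   characters is equality of functions. *)
Definition is_lchar (f : {ffun gT -> K}) : bool :=
  [forall x, (f x != 0) == (x \in M)] &&
  [forall x in M, forall y in M, f (x * y)%g == f x * f y].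

Record lchar : Type :=
  LChar { lchar_val :> {ffun gT -> K}; lchar_valP : is_lchar lchar_val }.

HB.instance Definition _ := [isSub for lchar_val].
HB.instance Definition _ := [Choice of lchar by <:].

Lemma is_lcharP (f : {ffun gT -> K}) :
  reflect ((forall x, (f x != 0) = (x \in M)) /\
           {in M &, forall x y, f (x * y)%g = f x * f y}) (is_lchar f).
Proof.
apply: (iffP andP) => [[/forallP f0 fM]|[f0 fM]]; split.
- by move=> x; rewrite (eqP (f0 x)).
- by move=> x y Mx My; have /forall_inP/(_ x Mx)/forall_inP/(_ y My)/eqP := fM.
- by apply/forallP=> x; rewrite f0.
- by apply/forall_inP=> x Mx; apply/forall_inP=> y My; rewrite fM.
Qed.

Lemma lchar_neq0 (f : lchar) x : (f x != 0) = (x \in M).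
Proof. by have /is_lcharP[-> _] := lchar_valP f. Qed.

Lemma lchar_out (f : lchar) x : x \notin M -> f x = 0.
Proof. by rewrite -(lchar_neq0 f) negbK => /eqP. Qed.

Lemma lcharM (f : lchar) : {in M &, forall x y, f (x * y)%g = f x * f y}.
Proof. by have /is_lcharP[_] := lchar_valP f. Qed.

Lemma lchar1 (f : lchar) : f 1%g = 1.
Proof.
have f1 : f 1%g != 0 by rewrite lchar_neq0 group1.
by apply: (mulfI f1); rewrite -lcharM ?group1 // mulg1 mulr1.
Qed.

Lemma lcharX (f : lchar) x n : x \in M -> f (x ^+ n)%g = f x ^+ n.
Proof.
move=> Mx; elim: n => [|n IH]; first by rewrite expg0 lchar1 expr0.
by rewrite expgS lcharM ?groupX // IH exprS.
Qed.

Lemma roots_enum (p : {poly K}) : p != 0 ->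
  exists rs : seq K, forall z, root p z -> z \in rs.
Proof.
move=> p0; apply: Classical_Prop.NNPP => no_rs.
have big n : exists rs : seq K, [/\ all (root p) rs, uniq rs & size rs = n].
  elim: n => [|n [rs [rP rU rS]]]; first by exists [::].
  case: (Classical_Prop.classic (exists z, root p z /\ z \notin rs)).
    by case=> z [pz zr]; exists (z :: rs); rewrite /= pz zr rS.
  move=> no_z; case: no_rs; exists rs => z pz; apply: contraT => zr.
  by case: no_z; exists z.
have [rs [rP rU rS]] := big (size p).
by have := max_poly_roots p0 rP rU; rewrite rS ltnn.
Qed.

Lemma lchar_enum : exists s : seq lchar, forall f, f \in s.
Proof.
pose n := #|M|.
have p0 : ('X^n - 1%:P : {poly K}) != 0.
  by rewrite -size_poly_gt0 size_XnsubC ?cardG_gt0.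
have [rs rsP] := roots_enum p0.
have val_rs (f : lchar) x : f x \in 0 :: rs.
  rewrite inE; case Mx: (x \in M); last by rewrite lchar_out ?Mx ?eqxx.
  by rewrite rsP ?orbT // /root !hornerE -lcharX // expg_cardG // lchar1 subrr.
pose T := {ffun gT -> seq_sub (0 :: rs)}.
pose F (t : T) : {ffun gT -> K} := [ffun x => val (t x)].
exists (pmap insub [seq F t | t : T]) => f; rewrite mem_pmap_sub /=.
apply/mapP; exists [ffun x => SeqSub (val_rs f x)]; rewrite ?mem_enum //.
by apply/ffunP=> x; rewrite !ffunE.
Qed.

Definition lchar_seq : seq lchar :=
  undup (sval (ClassicalEpsilon.constructive_indefinite_description _
                 lchar_enum)).

Lemma lchar_seqP : Finite.axiom lchar_seq.
Proof.
move=> f; rewrite count_uniq_mem ?undup_uniq // mem_undup.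
by case: ClassicalEpsilon.constructive_indefinite_description => s /= ->.
Qed.

Lemma lchar_pickleK :
  pcancel (fun f => index f lchar_seq) (nth None (map some lchar_seq)).
Proof.
move=> f; have f_in : f \in lchar_seq.
  by have := lchar_seqP f; rewrite -has_pred1 has_count => ->.
by rewrite (nth_map f) ?nth_index ?index_mem.
Qed.

HB.instance Definition _ := Choice_isCountable.Build lchar lchar_pickleK.
HB.instance Definition _ := isFinite.Build lchar lchar_seqP.

(* Pointwise group law. *)
Lemma lchar_one_subproof : is_lchar [ffun x => (x \in M)%:R].
Proof.
apply/is_lcharP; split=> [x|x y Mx My]; rewrite !ffunE.
  by case: (x \in M); rewrite ?oner_eq0 ?eqxx.
by rewrite Mx My groupM // mulr1.
Qed.

Lemma lchar_mul_subproof (f g : lchar) : is_lchar [ffun x => f x * g x].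
Proof.
apply/is_lcharP; split=> [x|x y Mx My]; rewrite !ffunE.
  by rewrite mulf_eq0 negb_or !lchar_neq0 andbb.
by rewrite !lcharM // mulrACA.
Qed.

Lemma lchar_inv_subproof (f : lchar) : is_lchar [ffun x => (f x)^-1].
Proof.
apply/is_lcharP; split=> [x|x y Mx My]; rewrite !ffunE.
  by rewrite invr_eq0 lchar_neq0.
by rewrite lcharM // invfM.
Qed.

Definition lchar_one := LChar lchar_one_subproof.
Definition lchar_mul f g := LChar (lchar_mul_subproof f g).
Definition lchar_inv f := LChar (lchar_inv_subproof f).

Lemma lchar_mulA : associative lchar_mul.
Proof. by move=> f g h; apply/val_inj/ffunP=> x; rewrite !ffunE mulrA. Qed.

Lemma lchar_mul1 : left_id lchar_one lchar_mul.
Proof.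
move=> f; apply/val_inj/ffunP=> x; rewrite !ffunE.
by case Mx: (x \in M); rewrite ?mul1r // mul0r lchar_out ?Mx.
Qed.

Lemma lchar_mulV : left_inverse lchar_one lchar_inv lchar_mul.
Proof.
move=> f; apply/val_inj/ffunP=> x; rewrite !ffunE.
case Mx: (x \in M); first by rewrite mulVf // lchar_neq0.
by rewrite lchar_out ?Mx // mulr0.
Qed.

HB.instance Definition _ := Finite_isGroup.Build lchar
  lchar_mulA lchar_mul1 lchar_mulV.

End LinearCharacters.

(** * Hopf algebras and Hopf orders *)

(* The structure maps of a Hopf algebra with underlying algebra hopf_alg.
   Whether a submodule is a Hopf order depends on these maps only. *)
Record hopf_data (K : fieldType) : Type := HopfData {
  hopf_alg :> falgType K;
  coprod : hopf_alg -> tens hopf_alg hopf_alg;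
  counit : hopf_alg -> K;
  antipode : hopf_alg -> hopf_alg }.

Arguments coprod {K} h _ : rename.
Arguments counit {K} h _ : rename.
Arguments antipode {K} h _ : rename.

Section HopfOrder.
Variables (K : fieldType) (R : K -> Prop).

Definition is_submodule (V : lmodType K) (X : V -> Prop) : Prop :=
  X 0 /\ forall r x y, R r -> X x -> X y -> X (r *: x + y).

Definition linear_on (V W : lmodType K) (X : V -> Prop) (f : V -> W) : Prop :=
  forall r x y, R r -> X x -> X y -> f (r *: x + y) = r *: f x + f y.

Definition free_module (n : nat) (u : 'rV[K]_n) : Prop := forall j, R (u 0 j).

(* X is an R-linear direct summand of some R^n. *)
Definition fg_projective (V : lmodType K) (X : V -> Prop) : Prop :=
  exists (n : nat) (i : V -> 'rV[K]_n) (p : 'rV[K]_n -> V),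
  [/\ forall x, X x -> free_module (i x),
      forall u, free_module u -> X (p u),
      linear_on X i, linear_on (@free_module n) p
    & forall x, X x -> p (i x) = x].

(* The R-balanced maps X x K -> A are those inducing X ⊗_R K -> A. *)
Definition balanced (V : lmodType K) (X : V -> Prop) (A : zmodType)
    (b : V -> K -> A) : Prop :=
  [/\ forall x y c, X x -> X y -> b (x + y) c = b x c + b y c,
      forall x c d, X x -> b x (c + d) = b x c + b x d
    & forall r x c, R r -> X x -> b (r *: x) c = b x (r * c)].

(* The natural map X ⊗_R K -> V, x ⊗ c |-> c x, is an isomorphism: V with the
   balanced map (x, c) |-> c x has the universal property of X ⊗_R K. *)
Definition base_change_iso (V : lmodType K) (X : V -> Prop) : Prop :=
  forall (A : zmodType) (b : V -> K -> A), balanced X b ->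
  exists2 f : {additive V -> A},
    forall x c, X x -> f (c *: x) = b x c
  & forall g : {additive V -> A},
      (forall x c, X x -> g (c *: x) = b x c) -> g =1 f.

(* The image of X ⊗_R X in H ⊗_K H (the coefficients in R are absorbed by X). *)
Definition tens_sub (H : vectType K) (X : H -> Prop) (t : tens H H) : Prop :=
  exists (n : nat) (x y : 'I_n -> H),
    (forall i, X (x i) /\ X (y i)) /\ t = \sum_i x i ⊗ y i.

Record hopf_order (H : hopf_data K) (X : H -> Prop) : Prop := {
  ho_submodule : is_submodule X;
  ho_projective : fg_projective X;
  ho_base_change : base_change_iso X;
  ho_one : X 1;
  ho_mul : forall x y, X x -> X y -> X (x * y);
  ho_coprod : forall x, X x -> tens_sub X (coprod H x);
  ho_counit : forall x, X x -> R (counit H x);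
  ho_antipode : forall x, X x -> X (antipode H x) }.

Definition admits_hopf_order (H : hopf_data K) : Prop :=
  exists X : H -> Prop, hopf_order X.

End HopfOrder.

Definition ring_of_integers (K : fieldExtType rat) : K -> Prop :=
  integralOver (intr : int -> K).

Arguments ring_of_integers K _ : clear implicits.

(** * Twisted group algebras *)

Definition group_hopf (K : fieldType) (gT : finGroupType) : hopf_data K :=
  @HopfData K (galg K gT)
    (fun h => \sum_x coeff h x *: (gelt K x ⊗ gelt K x))
    (fun h => \sum_x coeff h x)
    (fun h => \sum_x coeff h x *: gelt K x^-1%g).

Definition twist_hopf (K : fieldType) (H : hopf_data K) (J : tens H H) (U : H) :
    hopf_data K :=
  @HopfData K H (fun h => J * coprod H h * J^-1) (counit H)
    (fun h => U * antipode H h * U^-1).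

Section Twist.
Variables (K : fieldType) (gT : finGroupType) (M : {group gT}).
Local Notation hatM := (lchar K M).

Definition char_idem (phi : hatM) : galg K gT :=
  (#|M|%:R)^-1 *: \sum_(m in M) phi m^-1%g *: gelt K m.

Definition twist_of (w : hatM -> hatM -> K) : tens (galg K gT) (galg K gT) :=
  \sum_(phi : hatM) \sum_(psi : hatM)
    w phi psi *: (char_idem phi ⊗ char_idem psi).

Definition twist_antipode (w : hatM -> hatM -> K) : galg K gT :=
  \sum_(phi : hatM) w phi phi^-1%g *: char_idem phi.

Definition twisted_galg (w : hatM -> hatM -> K) : hopf_data K :=
  @twist_hopf K (group_hopf K gT) (twist_of w) (twist_antipode w).

End Twist.

(** * Cocycles and Lagrangian decompositions *)

Section Cocycles.
Variables (K : fieldType) (T : finGroupType).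
Implicit Type w : T -> T -> K.

Definition normalized_cocycle w : Prop :=
  [/\ forall a b, w a b != 0,
      forall a b c, w a b * w (a * b)%g c = w a (b * c)%g * w b c,
      forall a, w 1%g a = 1
    & forall a, w a 1%g = 1].

Definition pairing w (a b : T) : K := w a b * (w b a)^-1.

Definition nondegenerate_cocycle w : Prop :=
  forall a, (forall b, pairing w a b = 1) -> a = 1%g.

Definition perp w (L : {set T}) : {set T} :=
  [set a | [forall b in L, pairing w a b == 1]].

Definition lagrangian w (L : {set T}) : Prop := L = perp w L.

End Cocycles.

Definition central_type (gT : finGroupType) (M : {group gT}) : Prop :=
  exists (eT : finGroupType) (E : {group eT}),
    abelian E /\ M \isog setX E E.

Section LagrangianDecomposition.
Variables (K : fieldType) (gT : finGroupType) (M : {group gT}).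
Variables (w : lchar K M -> lchar K M -> K) (L : {group lchar K M}).
Local Notation hatL := (lchar K L).

(* s : ^L -> ^M is a splitting of pi : ^M -> ^L, pi(m)(l) = B_w(m, l), and
   (l, la) is identified with l * s la. *)
Definition lagrangian_decomposition (s : hatL -> lchar K M) : Prop :=
  [/\ lagrangian w L,
      {morph s : la mu / (la * mu)%g},
      forall la l, l \in L -> pairing w (s la) l = la l
    & forall l l' la la', l \in L -> l' \in L ->
        pairing w (l * s la)%g (l' * s la')%g = la l' * (la' l)^-1].

(* L viewed inside M: the element l' of L is the m in M at which every
   character (l, la) takes the value la(l'). *)
Definition lagrangian_in_group (s : hatL -> lchar K M) : {set gT} :=
  [set m in M | [exists l' in L, [forall l in L, [forall la : hatL,
     (l * s la)%g m == la l']]]].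

(* w is the cocycle ((l, la), (l', la')) |-> la(l') up to a coboundary. *)
Definition cohomologous_to_standard (s : hatL -> lchar K M) : Prop :=
  exists2 c : lchar K M -> K, forall phi, c phi != 0 &
  forall l l' la la', l \in L -> l' \in L ->
    let phi := (l * s la)%g in let psi := (l' * s la')%g in
    w phi psi = c phi * c psi * (c (phi * psi)%g)^-1 * la l'.

End LagrangianDecomposition.

(* Main.v *)
(* Up to conjugation by u = sum_phi c(phi) e_phi, where c is the cochain relating
   w to the standard cocycle, one may take J = sum_la e_la ⊗ la, the sum being
   over ^L seen in M, with e_la the idempotents of KL.  The R-span X of the
   e_nu g (nu a character of N, g in G) is a Hopf order of KG, since N is abelian
   and normal.  It contains G, and also the e_la: an idempotent of KN is a sum of
   some of the e_nu.  Hence J, J^-1, U_J and U_J^-1 have entries in X, so X is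
   a Hopf order of (KG)_J. *)
From HB Require Import structures.
Require Import Defs.
From mathcomp Require Import all_boot all_order all_fingroup all_algebra all_solvable all_field.
From mathcomp Require Import ring.

Set Implicit Arguments.
Unset Strict Implicit.
Unset Printing Implicit Defensive.

Import GRing.Theory.
Local Open Scope ring_scope.

(** * Modules with a finite dual basis *)

(** In the basis of group elements the idempotents [e_la] carry the denominator |L|, so the group
    ring [RG] is in general too small to contain the entries of [J]. Enlarging it by the [e_nu]
    absorbs the denominators: [X] is cut out by Fourier coefficients along the cosets of [N], and
    the coefficients of products, coproducts and antipodes of generators are zeros, ones and roots
    of unity. Accordingly [R] enters only as a set closed under sums and products that contains 0
    and the roots of unity of [K]. The cochain [c] has arbitrary nonzero values, so [u] need not lie
    in [X]. The order produced is therefore the conjugate [u X u^-1], tested through [u^-1 x u], and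
    the structure maps of [(KG)_J] become those of the standard twist after this conjugation. The
    [R]-module conditions are obtained from generators [e i] with [K]-linear coordinates [f i] that
    detect membership and reconstruct every vector. Such a frame is easily transported by
    conjugation. *)

Section Frame.
Variables (K : fieldType) (R : K -> Prop) (V : lmodType K) (X : V -> Prop).
Variables (I : finType) (e : I -> V) (f : I -> V -> K).
Hypotheses (R0 : R 0) (RD : forall a b, R a -> R b -> R (a + b)).
Hypothesis RM : forall a b, R a -> R b -> R (a * b).
Hypothesis f_lin : forall i a x y, f i (a *: x + y) = a * f i x + f i y.
Hypothesis XE : forall x, X x <-> forall i, R (f i x).
Hypothesis Xe : forall i, X (e i).
Hypothesis frame : forall x, x = \sum_i f i x *: e i.

Let fD i x y : f i (x + y) = f i x + f i y.
Proof. by rewrite -[x in LHS]scale1r f_lin mul1r. Qed.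

Let f0 i : f i 0 = 0.
Proof. by apply: (addrI (f i 0)); rewrite -fD !addr0. Qed.

Let fZ i a x : f i (a *: x) = a * f i x.
Proof. by rewrite -[_ *: _]addr0 f_lin f0 addr0. Qed.

Let X0 : X 0.
Proof. by apply/XE => i; rewrite f0. Qed.

Let XD x y : X x -> X y -> X (x + y).
Proof. by move=> /XE Xx /XE Xy; apply/XE => i; rewrite fD; apply: RD. Qed.

Let XZ a x : R a -> X x -> X (a *: x).
Proof. by move=> Ra /XE Xx; apply/XE => i; rewrite fZ; apply: RM. Qed.

Lemma frame_submodule : is_submodule R X.
Proof. by split=> // r x y Rr Xx Xy; apply: XD => //; apply: XZ. Qed.

Lemma frame_sum (J : finType) (r : J -> K) (v : J -> V) :
  (forall j, R (r j)) -> (forall j, X (v j)) -> X (\sum_j r j *: v j).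
Proof. by move=> Rr Xv; apply: big_ind => // j _; apply: XZ. Qed.

Lemma frame_projective : fg_projective R X.
Proof.
pose p (u : 'rV[K]_#|I|) := \sum_i u 0 (enum_rank i) *: e i.
exists #|I|, (fun x => \row_j f (enum_val j) x), p; split.
- by move=> x /XE Xx j; rewrite mxE.
- by move=> u Ru; apply: frame_sum.
- by move=> r x y _ _ _; apply/rowP => j; rewrite !mxE f_lin.
- move=> r x y _ _ _; rewrite /p scaler_sumr -big_split /=.
  by apply: eq_bigr => i _; rewrite !mxE scalerDl scalerA.
- move=> x _; rewrite [RHS]frame; apply: eq_bigr => i _.
  by rewrite mxE enum_rankK.
Qed.

(** The frame forces the induced map: it must send [x] to the sum of the [b (e i) (f i x)].
    Balancing over [R] shows that this map works, since [f i x] lies in [R] when [x] lies in [X]. *)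
Lemma frame_base_change : base_change_iso R X.
Proof.
move=> A b [bDl bDr bZ].
have b0r x : X x -> b x 0 = 0.
  by move=> Xx; apply: (addrI (b x 0)); rewrite -bDr // !addr0.
have b0l c : b 0 c = 0 by apply: (addrI (b 0 c)); rewrite -bDl // !addr0.
pose F x := \sum_i b (e i) (f i x).
have FD : GRing.nmod_morphism F.
  split=> [|x y]; rewrite /F -?big_split /=.
    by rewrite big1 // => i _; rewrite f0 b0r.
  by apply: eq_bigr => i _; rewrite fD bDr.
pose Fm := GRing.isNmodMorphism.Build _ _ F FD.
exists (HB.pack F Fm : {additive V -> A}) => [x c /XE Rfx | g gE x] /=.
  have -> : F (c *: x) = \sum_i b (f i x *: e i) c.
    by apply: eq_bigr => i _; rewrite bZ // fZ mulrC.
  rewrite [in RHS](frame x).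
  (* [b] is additive only on [X], so membership of the partial sums is carried along in the
     induction. *)
  have [//] : \sum_i b (f i x *: e i) c = b (\sum_i f i x *: e i) c
            /\ X (\sum_i f i x *: e i).
  apply: (big_ind2 (fun a v => a = b v c /\ X v)) => //.
    by move=> a v a' v' [-> Xv] [-> Xv']; split; [rewrite bDl | apply: XD].
  by move=> i _; split=> //; apply: XZ.
by rewrite [in LHS](frame x) raddf_sum; apply: eq_bigr => i _; rewrite /= gE.
Qed.

End Frame.

(** * Tensors and group algebras *)

Section TensorSums.
Variables (K : fieldType).

Lemma pure_suml (U V : vectType K) (I : finType) (u : I -> U) (v : V) :
  (\sum_i u i) ⊗ v = \sum_i u i ⊗ v.
Proof.
elim/big_rec2: _ => [|i x y _ <-]; last by rewrite pureDl.
by rewrite -(scale0r 0) pureZl scale0r.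
Qed.

Lemma pure_sumr (U V : vectType K) (I : finType) (u : U) (v : I -> V) :
  u ⊗ (\sum_i v i) = \sum_i u ⊗ v i.
Proof.
elim/big_rec2: _ => [|i x y _ <-]; last by rewrite pureDr.
by rewrite -(scale0r 0) pureZr scale0r.
Qed.

Variables (H : falgType K) (X : H -> Prop).

Lemma pure_mul (a b c d : H) : (a ⊗ b) * (c ⊗ d) = (a * c) ⊗ (b * d).
Proof. exact: tmul_pure. Qed.

Lemma tens_sub_pure (x y : H) : X x -> X y -> tens_sub X (x ⊗ y).
Proof.
by move=> Xx Xy; exists 1%N, (fun=> x), (fun=> y); rewrite big_ord1.
Qed.

Lemma tens_sub0 : tens_sub X 0.
Proof.
by exists 0%N, (fun=> 0), (fun=> 0); split=> [[]|] //; rewrite big_ord0.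
Qed.

Lemma tens_subD s t : tens_sub X s -> tens_sub X t -> tens_sub X (s + t).
Proof.
move=> [m [x [y [Xxy ->]]]] [n [x' [y' [Xxy' ->]]]].
exists (m + n)%N, (fun i => match split i with inl j => x j | inr k => x' k end),
  (fun i => match split i with inl j => y j | inr k => y' k end); split.
  by move=> i; case: (split i).
rewrite big_split_ord /=; congr (_ + _); apply: eq_bigr => i _.
  by rewrite (unsplitK (inl i)).
by rewrite (unsplitK (inr i)).
Qed.

Lemma tens_sub_sum (I : finType) (t : I -> tens H H) :
  (forall i, tens_sub X (t i)) -> tens_sub X (\sum_i t i).
Proof.
by move=> Xt; apply: big_ind => //; [apply: tens_sub0|apply: tens_subD].
Qed.

Lemma tens_subM s t : (forall x y, X x -> X y -> X (x * y)) ->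
  tens_sub X s -> tens_sub X t -> tens_sub X (s * t).
Proof.
move=> XM [m [x [y [Xxy ->]]]] [n [x' [y' [Xxy' ->]]]].
rewrite mulr_suml; apply: tens_sub_sum => i; rewrite mulr_sumr.
apply: tens_sub_sum => j; rewrite pure_mul.
by case: (Xxy i) (Xxy' j) => ? ? [? ?]; apply: tens_sub_pure; apply: XM.
Qed.

End TensorSums.

(** * The structure maps of the group algebra, computed on group elements *)

Section GroupAlgebraHopf.
Variables (K : fieldType) (gT : finGroupType).
Local Notation A := (galg K gT).
Local Notation g_ := (@gelt K gT).
Local Notation D := (coprod (group_hopf K gT)).
Local Notation S := (antipode (group_hopf K gT)).
Local Notation eps := (counit (group_hopf K gT)).

Lemma coeff_gelt x y : coeff (g_ x) y = (y == x)%:R.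
Proof. exact: coeffE. Qed.

Lemma coeffM (f g : A) x :
  coeff (f * g) x = \sum_y coeff f y * coeff g (y^-1 * x)%g.
Proof. exact: coeffE. Qed.

Lemma coeff0 x : coeff (0 : A) x = 0.
Proof. by rewrite /coeff ffunE. Qed.

Lemma coeff_sum (I : Type) (r : seq I) (P : pred I) (F : I -> A) x :
  coeff (\sum_(i <- r | P i) F i) x = \sum_(i <- r | P i) coeff (F i) x.
Proof.
by elim/big_rec2: _ => [|i a b _ <-]; rewrite ?coeff0 ?coeffD.
Qed.

Lemma coeffMgelt (f : A) h x : coeff (f * g_ h) x = coeff f (x * h^-1)%g.
Proof.
rewrite coeffM (bigD1 (x * h^-1)%g) //= big1 => [|y ny].
  by rewrite coeff_gelt invMg invgK mulgKV eqxx mulr1 addr0.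
rewrite coeff_gelt; case: eqP => [yx|_]; last by rewrite mulr0.
by rewrite -yx invMg invgK mulKVg eqxx in ny.
Qed.

Lemma geltM x y : g_ x * g_ y = g_ (x * y)%g.
Proof.
apply: galgP => z; rewrite coeffMgelt !coeff_gelt.
by rewrite -(inj_eq (mulIg y)) mulgKV.
Qed.

Lemma galg_sum (f : A) : f = \sum_x coeff f x *: g_ x.
Proof.
apply: galgP => x; rewrite coeff_sum (bigD1 x) //= big1 => [|y /negPf nyx].
  by rewrite coeffZ coeff_gelt eqxx mulr1 addr0.
by rewrite coeffZ coeff_gelt eq_sym nyx mulr0.
Qed.

Lemma galg_ind (P : A -> Prop) :
  (forall f g, P f -> P g -> P (f + g)) -> (forall a x, P (a *: g_ x)) ->
  forall f, P f.
Proof.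
move=> PD Pg f; rewrite [f]galg_sum; apply: (big_ind P) => //.
by rewrite -(scale0r (g_ 1%g)).
Qed.

Lemma coprod_is_linear : linear (D : A -> tens A A).
Proof.
move=> a f g /=; rewrite scaler_sumr -big_split; apply: eq_bigr => x _.
by rewrite coeffD coeffZ scalerDl scalerA.
Qed.
HB.instance Definition _ := GRing.isLinear.Build K A (tens A A) *:%R
  (D : A -> tens A A) coprod_is_linear.

Lemma coprodD (f g : A) : D (f + g) = D f + D g.
Proof. exact: linearD. Qed.

Lemma coprodZ a (f : A) : D (a *: f) = a *: D f.
Proof. exact: linearZ. Qed.

Lemma coprod_sum (I : finType) (F : I -> A) :
  D (\sum_i F i) = \sum_i D (F i).
Proof. exact: linear_sum. Qed.

Lemma antipode_is_linear : linear (S : A -> A).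
Proof.
move=> a f g /=; rewrite scaler_sumr -big_split; apply: eq_bigr => x _.
by rewrite coeffD coeffZ scalerDl scalerA.
Qed.
HB.instance Definition _ := GRing.isLinear.Build K A A *:%R
  (S : A -> A) antipode_is_linear.

Lemma antipodeD (f g : A) : S (f + g) = S f + S g.
Proof. exact: linearD. Qed.

Lemma antipodeZ a (f : A) : S (a *: f) = a *: S f.
Proof. exact: linearZ. Qed.

Lemma antipode_sum (I : finType) (F : I -> A) :
  S (\sum_i F i) = \sum_i S (F i).
Proof. exact: linear_sum. Qed.

Lemma coprod_gelt x : D (g_ x) = g_ x ⊗ g_ x.
Proof.
rewrite /= (bigD1 x) //= coeff_gelt eqxx scale1r big1 ?addr0 // => y nyx.
by rewrite coeff_gelt (negPf nyx) scale0r.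
Qed.

Lemma antipode_gelt x : S (g_ x) = g_ x^-1%g.
Proof.
rewrite /= (bigD1 x) //= coeff_gelt eqxx scale1r big1 ?addr0 // => y nyx.
by rewrite coeff_gelt (negPf nyx) scale0r.
Qed.

Lemma coprodM (f g : A) : D (f * g) = D f * D g.
Proof.
elim/galg_ind: f => [f f' ef ef'|a x].
  by rewrite mulrDl !coprodD ef ef' mulrDl.
elim/galg_ind: g => [g g' eg eg'|b y].
  by rewrite mulrDr !coprodD eg eg' mulrDr.
by rewrite -scalerAl -scalerAr !coprodZ -scalerAl -scalerAr geltM
  !coprod_gelt pure_mul geltM.
Qed.

Lemma antipodeM (f g : A) : S (f * g) = S g * S f.
Proof.
elim/galg_ind: f => [f f' ef ef'|a x].
  by rewrite mulrDl !antipodeD ef ef' mulrDr.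
elim/galg_ind: g => [g g' eg eg'|b y].
  by rewrite mulrDr !antipodeD eg eg' mulrDl.
rewrite -scalerAl -scalerAr !antipodeZ -scalerAl -scalerAr geltM.
by rewrite !antipode_gelt geltM invMg !scalerA mulrC.
Qed.

Lemma counitM (f g : A) : eps (f * g) = eps f * eps g.
Proof.
rewrite /= mulr_suml; under eq_bigr do rewrite coeffM.
rewrite exchange_big; apply: eq_bigr => y _ /=.
by rewrite -mulr_sumr; congr (_ * _); rewrite [RHS](reindex_inj (mulgI y^-1%g)).
Qed.

End GroupAlgebraHopf.

(** * Characters and diagonal elements *)

Definition separating (K : fieldType) (gT : finGroupType) (M : {group gT}) :=
  forall x, x \in M -> x != 1%g -> exists phi : lchar K M, phi x != 1.

(** A coordinate of an algebra isomorphism from [KM] to [K^n] restricts to a character of [M]. If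
    all of them took the value 1 at [x], injectivity would give [x = 1]. *)
Lemma split_separating (K : fieldType) (gT : finGroupType) (M : {group gT}) :
  split_algebra (galg K (subg_of M)) -> separating K M.
Proof.
move=> [n [f [g fK _]]] x Mx nx1.
have [i fi] : exists i, f (gelt K (subg M x)) i != 1.
  apply/existsP; apply: contraR nx1; rewrite negb_exists => /forallP f1.
  have /(can_inj fK)/(congr1 (fun h => coeff h 1%g)) :
      f (gelt K (subg M x)) = f 1.
    by rewrite rmorph1; apply/ffunP => i; have := f1 i; rewrite negbK !ffunE => /eqP.
  rewrite [RHS]coeff_gelt coeff_gelt eqxx; case: eqP => [/esym/eqP|_ /eqP].
    by rewrite -(inj_eq val_inj) /= subgK.
  by rewrite eq_sym oner_eq0.
have fM y z : f (gelt K (y * z)%g) i = f (gelt K y) i * f (gelt K z) i.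
  by rewrite -geltM rmorphM ffunE.
have f0 y : f (gelt K y) i != 0.
  have : f (gelt K y) i * f (gelt K y^-1%g) i = 1.
    rewrite -fM mulgV; have -> : gelt K (1%g : subg_of M) = 1 by [].
    by rewrite rmorph1 ffunE.
  by apply: contra_eqN => /eqP ->; rewrite mul0r eq_sym oner_eq0.
pose c : {ffun gT -> K} :=
  [ffun y => (if y \in M then f (gelt K (subg M y)) i else 0) : K].
have cP : is_lchar M c.
  apply/is_lcharP; split=> [y|y z My Mz]; rewrite !ffunE.
    by case: (y \in M); rewrite ?f0 ?eqxx.
  by rewrite groupM // My Mz -fM -(morphM (subg_morphism M)).
by exists (LChar cP); rewrite /= ffunE Mx.
Qed.

(** * Orthogonality relations for characters *)

Section CharacterSums.
Variables (K : fieldType) (gT : finGroupType) (M : {group gT}).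
Implicit Types phi psi : lchar K M.

Lemma mul_lcharE phi psi x : (phi * psi)%g x = phi x * psi x.
Proof. by rewrite ffunE. Qed.

Lemma one_lcharE x : (1%g : lchar K M) x = (x \in M)%:R.
Proof. by rewrite ffunE. Qed.

Lemma inv_lcharE phi x : phi^-1%g x = (phi x)^-1.
Proof. by rewrite ffunE. Qed.

Lemma lchar_mulC phi psi : (phi * psi = psi * phi)%g.
Proof. by apply/val_inj/ffunP => x; rewrite !ffunE mulrC. Qed.

Lemma lcharV phi x : phi x^-1%g = (phi x)^-1.
Proof.
case Mx: (x \in M); last by rewrite !lchar_out ?groupV ?Mx // invr0.
have phi0 : phi x != 0 by rewrite lchar_neq0.
by apply: (mulfI phi0); rewrite -lcharM ?groupV // mulgV lchar1 divff.
Qed.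

Lemma lchar_eq phi psi : (forall x, x \in M -> phi x = psi x) -> phi = psi.
Proof.
move=> eq; apply/val_inj/ffunP => x.
by case Mx: (x \in M); [apply: eq | rewrite !lchar_out ?Mx].
Qed.

(** Translation by some [y] with [phi y != 1] multiplies the sum by [phi y] without changing it, so
    the sum vanishes. *)
Lemma sum_group_lchar phi : \sum_(x in M) phi x = #|M|%:R * (phi == 1%g)%:R.
Proof.
case: eqP => [->|nphi1].
  rewrite mulr1 -sumr_const; apply: eq_bigr => x Mx.
  by rewrite one_lcharE Mx.
have [y My phiy] : exists2 y, y \in M & phi y != 1.
  apply/exists_inP; apply: contra_notT nphi1; rewrite negb_exists_in.
  move/forall_inP => h; apply: lchar_eq => x Mx.
  by rewrite one_lcharE Mx; apply/eqP; have := h x Mx; rewrite negbK.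
rewrite mulr0; apply/eqP; apply: contraNT phiy => nz.
apply/eqP/(mulIf nz); rewrite mul1r [RHS](reindex_inj (mulgI y)) mulr_sumr /=.
apply: eq_big => x; first by rewrite groupMl.
by move=> Mx; rewrite lcharM.
Qed.

Lemma sum_group_lchar_mul phi psi :
  \sum_(x in M) phi x^-1%g * psi x = #|M|%:R * (phi == psi)%:R.
Proof.
have -> : (phi == psi) = ((phi^-1 * psi)%g == 1%g) by rewrite eq_mulVg1.
rewrite -sum_group_lchar; apply: eq_bigr => x _.
by rewrite mul_lcharE inv_lcharE lcharV.
Qed.

Hypothesis sepM : separating K M.

Lemma sum_lchar x : x \in M ->
  \sum_(phi : lchar K M) phi x = #|M|%:R * (x == 1%g)%:R.
Proof.
have off y : y \in M -> y != 1%g -> \sum_(phi : lchar K M) phi y = 0.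
  move=> My /(sepM My)[psi psiy]; apply/eqP; apply: contraNT psiy => nz.
  apply/eqP/(mulIf nz); rewrite mul1r [RHS](reindex_inj (mulgI psi)) mulr_sumr.
  by apply: eq_bigr => phi _; rewrite mul_lcharE.
have [-> _|nx1 Mx] := eqVneq x 1%g; last by rewrite off // mulr0.
rewrite mulr1.
(* Summing phi y over all phi and y in both orders yields |^M| = |M|. *)
transitivity (\sum_(y in M) \sum_(phi : lchar K M) phi y).
  rewrite [RHS](bigD1 1%g) //= [X in _ + X]big1 ?addr0 // => y /andP[].
  exact: off.
rewrite exchange_big (bigD1 1%g) // sum_group_lchar eqxx mulr1 big1.
  exact: addr0.
by move=> phi /negPf n1; rewrite sum_group_lchar n1 mulr0.
Qed.

End CharacterSums.

(** * Fourier calculus in [KM] and [KM ⊗ KM] *)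

Section Diagonal.
Variables (K : fieldType) (gT : finGroupType) (M : {group gT}).
Hypotheses (nzM : #|M|%:R != 0 :> K).
Local Notation A := (galg K gT).
Local Notation hatM := (lchar K M).
Local Notation e_ := (@char_idem K gT M).
Local Notation g_ := (@gelt K gT).
Local Notation D := (coprod (group_hopf K gT)).
Local Notation S := (antipode (group_hopf K gT)).

(** Inverse Fourier transform: it identifies functions on [^M] with [KM] and makes the product
    pointwise. [twist_of] is the same construction for functions of two characters. *)
Definition diag (f : hatM -> K) : A := \sum_phi f phi *: e_ phi.

Lemma eq_diag f g : f =1 g -> diag f = diag g.
Proof. by move=> fg; apply: eq_bigr => phi _; rewrite fg. Qed.

Lemma eq_twist_of (F G : hatM -> hatM -> K) : F =2 G -> twist_of F = twist_of G :> tens A A.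
Proof.
by move=> FG; apply: eq_bigr => phi _; apply: eq_bigr => psi _; rewrite FG.
Qed.

Lemma coeff_char_idem phi x : coeff (e_ phi) x = #|M|%:R^-1 * phi x^-1%g.
Proof.
rewrite /char_idem coeffZ coeff_sum; congr (_ * _).
case Mx: (x \in M).
  rewrite (bigD1 x) //= big1 => [|y /andP[_ /negPf nyx]].
    by rewrite addr0 coeffZ coeff_gelt eqxx mulr1.
  by rewrite coeffZ coeff_gelt eq_sym nyx mulr0.
rewrite lchar_out ?groupV ?Mx // big1 // => y My.
by rewrite coeffZ coeff_gelt; case: eqP Mx My => [-> ->|_]; rewrite ?mulr0.
Qed.

Lemma gelt_char_idem m phi : m \in M -> g_ m * e_ phi = phi m *: e_ phi.
Proof.
move=> Mm; rewrite /char_idem -scalerAr scalerA mulrC -scalerA; congr (_ *: _).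
rewrite mulr_sumr scaler_sumr [RHS](reindex_inj (mulgI m)) /=.
apply: eq_big => [x|x Mx]; first by rewrite groupMl.
rewrite -scalerAr geltM scalerA !lcharV lcharM // invfM mulVKf //.
by rewrite lchar_neq0.
Qed.

Lemma char_idemM phi psi : e_ phi * e_ psi = (phi == psi)%:R *: e_ psi.
Proof.
rewrite {1}/char_idem -scalerAl mulr_suml.
have -> : (phi == psi)%:R = #|M|%:R^-1 * (\sum_(x in M) phi x^-1%g * psi x).
  by rewrite sum_group_lchar_mul mulKf.
rewrite -scalerA; congr (_ *: _); rewrite scaler_suml; apply: eq_bigr => x Mx.
by rewrite -scalerAl gelt_char_idem // scalerA.
Qed.

Lemma diagM f g : diag f * diag g = diag (fun phi => f phi * g phi).
Proof.
rewrite /diag mulr_suml; apply: eq_bigr => phi _.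
rewrite mulr_sumr (bigD1 phi) //= big1 => [|psi /negPf n].
  by rewrite -scalerAl -scalerAr char_idemM eqxx scale1r addr0 scalerA.
by rewrite -scalerAl -scalerAr char_idemM eq_sym n scale0r !scaler0.
Qed.

Lemma twist_ofM F G :
  twist_of F * twist_of G = twist_of (fun a b : hatM => F a b * G a b) :> tens A A.
Proof.
rewrite /twist_of mulr_suml; apply: eq_bigr => a _.
rewrite mulr_suml; apply: eq_bigr => b _.
rewrite mulr_sumr (big_only1 a) // => [|c /negPf n _]; last first.
  rewrite mulr_sumr big1 // => d _.
  rewrite -scalerAl -scalerAr pure_mul !char_idemM eq_sym n.
  by rewrite scale0r -(scale0r 0) pureZl scale0r !scaler0.
rewrite mulr_sumr (big_only1 b) // => [|c /negPf n _].
  by rewrite -scalerAl -scalerAr pure_mul !char_idemM !eqxx !scale1r scalerA.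
rewrite -scalerAl -scalerAr pure_mul !char_idemM [b == _]eq_sym n.
by rewrite scale0r -(scale0r 0) pureZr scale0r !scaler0.
Qed.

Lemma diag_pure f g : diag f ⊗ diag g = twist_of (fun a b : hatM => f a * g b).
Proof.
rewrite /diag pure_suml; apply: eq_bigr => a _; rewrite pure_sumr.
by apply: eq_bigr => b _; rewrite pureZl pureZr scalerA.
Qed.

Lemma antipode_diag f : S (diag f) = diag (fun phi => f phi^-1%g).
Proof.
rewrite /diag antipode_sum (reindex_inj invg_inj); apply: eq_bigr => phi _.
rewrite antipodeZ; congr (_ *: _); apply: galgP => x.
rewrite coeff_char_idem -[LHS]/(coeff (\sum_y _) x) coeff_sum.
rewrite (bigD1 x^-1%g) //= big1 => [|y nyx].
  by rewrite coeffZ coeff_gelt invgK eqxx mulr1 addr0 coeff_char_idem inv_lcharE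
    lcharV invrK.
rewrite coeffZ coeff_gelt; case: eqP => [xy|]; rewrite ?mulr0 //.
by rewrite xy invgK eqxx in nyx.
Qed.

Lemma twist_of_sum (I : finType) (F : I -> hatM -> hatM -> K) :
  \sum_i twist_of (F i) = twist_of (fun a b => \sum_i F i a b) :> tens A A.
Proof.
rewrite exchange_big; apply: eq_bigr => a _ /=.
rewrite exchange_big; apply: eq_bigr => b _ /=.
by rewrite scaler_suml.
Qed.

Lemma diag_sum (I : finType) (F : I -> hatM -> K) :
  \sum_i diag (F i) = diag (fun a => \sum_i F i a).
Proof.
by rewrite exchange_big; apply: eq_bigr => a _ /=; rewrite scaler_suml.
Qed.

Lemma diagZ c f : c *: diag f = diag (fun a => c * f a).
Proof. by rewrite scaler_sumr; apply: eq_bigr => a _; rewrite scalerA. Qed.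

Lemma coeff_diag f x :
  coeff (diag f) x = #|M|%:R^-1 * \sum_(phi : hatM) f phi * phi x^-1%g.
Proof.
rewrite coeff_sum mulr_sumr; apply: eq_bigr => phi _.
by rewrite coeffZ coeff_char_idem mulrCA.
Qed.

Lemma diag_fourier f (phi : hatM) : \sum_(x in M) coeff (diag f) x * phi x = f phi.
Proof.
under eq_bigr => x _ do rewrite coeff_diag mulrAC mulr_sumr.
rewrite exchange_big (big_only1 phi) // => [|psi npsi _].
  rewrite (eq_bigr (fun x => #|M|%:R^-1 * f phi * (phi x^-1%g * phi x))).
    by rewrite -mulr_sumr sum_group_lchar_mul eqxx mulr1 mulrAC mulVf ?mul1r.
  by move=> x _; ring.
rewrite (eq_bigr (fun x => #|M|%:R^-1 * f psi * (psi x^-1%g * phi x))).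
  by rewrite -mulr_sumr sum_group_lchar_mul (negPf npsi) !mulr0.
by move=> x _; ring.
Qed.

Lemma diag_out f x : x \notin M -> coeff (diag f) x = 0.
Proof.
move=> nMx; rewrite coeff_diag big1 ?mulr0 // => phi _.
by rewrite lchar_out ?groupV // mulr0.
Qed.

Hypothesis sepM : separating K M.

(** Under the Fourier transform an element of [M] is evaluation of characters at it. Orthogonality
    in the sum over characters, hence separation, enters here. *)
Lemma gelt_diag m : m \in M -> g_ m = diag (fun phi : hatM => phi m).
Proof.
move=> Mm; apply: galgP => x; rewrite coeff_gelt.
case Mx: (x \in M); last first.
  by rewrite diag_out ?Mx //; case: eqP Mx => // ->; rewrite Mm.
rewrite coeff_diag; under eq_bigr => phi _ do rewrite -lcharM ?groupV //.
by rewrite sum_lchar ?groupM ?groupV // mulKf // eq_sym eq_mulgV1.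
Qed.

Lemma diag1 : diag (fun=> 1) = 1.
Proof. by rewrite [RHS]gelt_diag //; apply: eq_diag => phi; rewrite lchar1. Qed.

Lemma twist_of1 : twist_of (fun _ _ : hatM => 1) = 1 :> tens A A.
Proof.
rewrite -[RHS]/(1 ⊗ 1) -diag1 diag_pure.
by apply: eq_twist_of => a b; rewrite mulr1.
Qed.

Lemma diag_inv f : (forall a, f a != 0) ->
  (diag f)^-1 = diag (fun a => (f a)^-1).
Proof.
move=> nz; set g := (RHS); have fg : diag f * g = 1.
  by rewrite diagM -diag1; apply: eq_diag => a; rewrite divff.
have gf : g * diag f = 1.
  by rewrite diagM -diag1; apply: eq_diag => a; rewrite mulVf.
have uf : diag f \is a GRing.unit by apply/unitrP; exists g.
by apply: (mulrI uf); rewrite divrr.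
Qed.

Lemma twist_of_inv F : (forall a b : hatM, F a b != 0) ->
  (twist_of F : tens A A)^-1 = twist_of (fun a b => (F a b)^-1).
Proof.
move=> nz; set G := (RHS); have FG : twist_of F * G = 1.
  by rewrite twist_ofM -twist_of1; apply: eq_twist_of => a b; rewrite divff.
have GF : G * twist_of F = 1.
  by rewrite twist_ofM -twist_of1; apply: eq_twist_of => a b; rewrite mulVf.
have uf : (twist_of F : tens A A) \is a GRing.unit by apply/unitrP; exists G.
by apply: (mulrI uf); rewrite divrr.
Qed.

(** The coproduct of [KM] is dual to the multiplication of [^M]. By linearity it suffices to treat
    one idempotent [e_a]: its group elements are grouplike, and averaging [a(m^-1) (b c)(m)] over
    [M] leaves the indicator of [a = b c]. *)
Lemma coprod_diag f : D (diag f) = twist_of (fun a b => f (a * b)%g).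
Proof.
pose d a b c : K := (a == b * c :> hatM)%g%:R.
have De a : D (e_ a) = twist_of (d a).
  rewrite /char_idem coprodZ big_mkcond coprod_sum.
  transitivity (#|M|%:R^-1 *: \sum_m twist_of (fun b c : hatM =>
      if m \in M then a m^-1%g * (b * c)%g m else 0) : tens A A).
    congr (_ *: _); apply: eq_bigr => m _; case: ifP => Mm; last first.
      rewrite -(scale0r 0) coprodZ scale0r /twist_of big1 // => b _.
      by rewrite big1 // => c _; rewrite scale0r.
    rewrite coprodZ coprod_gelt !gelt_diag // diag_pure /twist_of scaler_sumr.
    apply: eq_bigr => b _; rewrite scaler_sumr; apply: eq_bigr => c _.
    by rewrite scalerA mul_lcharE.
  rewrite twist_of_sum /twist_of scaler_sumr; apply: eq_bigr => b _.
  rewrite scaler_sumr; apply: eq_bigr => c _; rewrite scalerA; congr (_ *: _).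
  by rewrite -big_mkcond sum_group_lchar_mul mulKf.
rewrite /diag coprod_sum.
transitivity (\sum_a twist_of (fun b c => f a * d a b c) : tens A A).
  apply: eq_bigr => a _; rewrite coprodZ De /twist_of scaler_sumr.
  apply: eq_bigr => b _; rewrite scaler_sumr; apply: eq_bigr => c _.
  by rewrite scalerA.
rewrite twist_of_sum; apply: eq_twist_of => b c.
rewrite (bigD1 (b * c)%g) //= big1 /d ?eqxx ?mulr1 ?addr0 // => a /negPf ->.
by rewrite mulr0.
Qed.

(* [diag chi] is grouplike, that is, its coefficients are orthogonal
   idempotents of [K]. *)
Lemma diag_morph_gelt (chi : hatM -> K) :
  {morph chi : a b / (a * b)%g >-> a * b} -> chi 1%g = 1 ->
  exists2 m, m \in M & forall phi : hatM, phi m = chi phi.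
Proof.
move=> chiM chi1; pose z x := coeff (diag chi) x.
have zM x y : x \in M -> y \in M -> z x * z y = (x == y)%:R * z y.
  move=> Mx My; rewrite /z !coeff_diag mulrACA.
  (* Substituting [b = a^-1 c] merges the two values of [chi] into [chi c]. What depends on [a] is
     then [a(x^-1 y)], whose sum over all characters is |M| or 0. *)
  have -> : (\sum_(a : hatM) chi a * a x^-1%g) *
                (\sum_(b : hatM) chi b * b y^-1%g) =
      (\sum_(c : hatM) (chi c * c y^-1%g)) *
      (\sum_(a : hatM) a (x^-1 * y)%g).
    rewrite mulr_suml mulr_sumr.
    under eq_bigr => a _ do
      rewrite (reindex_inj (mulgI a^-1%g)) mulr_sumr.
    under [RHS]eq_bigr => a _ do rewrite mulr_suml.
    apply: eq_bigr => a _; apply: eq_bigr => c _.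
    have -> : chi c = chi a * chi (a^-1 * c)%g by rewrite -chiM mulKVg.
    rewrite mul_lcharE inv_lcharE lcharM ?groupV // !(lcharV a) invrK.
    by ring.
  rewrite sum_lchar ?groupM ?groupV // -eq_mulVg1.
  by rewrite mulrACA mulKf // mulrC.
have chiE phi : chi phi = \sum_(x in M) z x * phi x by rewrite diag_fourier.
have [m Mm zm] : exists2 m, m \in M & z m != 0.
  apply/exists_inP; apply: contra_eqT chi1; rewrite negb_exists_in.
  move=> /forall_inP z0; rewrite chiE big1 1?eq_sym ?oner_eq0 // => x Mx.
  by have := z0 x Mx; rewrite negbK => /eqP ->; rewrite mul0r.
exists m => // phi; rewrite chiE (bigD1 m) //= big1 => [|x /andP[Mx nxm]].
  have -> : z m = 1 by apply: (mulIf zm); rewrite zM // eqxx.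
  by rewrite mul1r addr0.
suff -> : z x = 0 by rewrite mul0r.
by apply: (mulfI zm); rewrite zM // eq_sym (negPf nxm) mul0r mulr0.
Qed.

End Diagonal.

(** * The order spanned by the e_nu g *)

Section FourierOrder.
Variables (K : fieldType) (R : K -> Prop) (gT : finGroupType) (N : {group gT}).
Hypotheses (R0 : R 0) (RD : forall a b, R a -> R b -> R (a + b)).
Hypotheses (RM : forall a b, R a -> R b -> R (a * b)).
Hypothesis Rroot : forall n z, (0 < n)%N -> z ^+ n = 1 -> R z.
Hypotheses (nzN : #|N|%:R != 0 :> K) (sepN : separating K N).
Hypothesis normN : (N <| [set: gT])%g.
Local Notation A := (galg K gT).
Local Notation hatN := (lchar K N).
Local Notation e_ := (@char_idem K gT N).
Local Notation g_ := (@gelt K gT).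
Local Notation D := (coprod (group_hopf K gT)).
Local Notation S := (antipode (group_hopf K gT)).
Local Notation eps := (counit (group_hopf K gT)).

Let R1 : R 1.
Proof. by apply: (@Rroot 1%N). Qed.

Let Rlchar (nu : hatN) x : R (nu x).
Proof.
case Nx: (x \in N); last by rewrite lchar_out ?Nx.
by apply: (@Rroot #|N|); rewrite ?cardG_gt0 // -lcharX // expg_cardG ?lchar1.
Qed.

Let Rbool (b : bool) : R b%:R.
Proof. by case: b. Qed.

(* If [x] is supported on the coset [N g], then
   [char_idem nu * x = fourier nu g x *: char_idem nu * gelt g]. *)
Definition fourier (nu : hatN) g (x : A) : K :=
  \sum_(n in N) coeff x (n * g)%g * nu n.

(** The [R]-span of the [e_nu g], given by coordinates instead of generators. Testing every [g]
    keeps the choice of coset representatives out of the definition. *)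
Definition fourier_order (x : A) : Prop := forall nu g, R (fourier nu g x).
Local Notation X := fourier_order.

Lemma fourier_is_linear nu g a x y :
  fourier nu g (a *: x + y) = a * fourier nu g x + fourier nu g y.
Proof.
rewrite mulr_sumr -big_split; apply: eq_bigr => n _ /=.
by rewrite coeffD coeffZ; ring.
Qed.

(** A change of representative within a coset costs only a root of unity, which lies in [R]; so one
    representative per coset suffices to test membership. *)
Lemma fourier_mull nu k g x : k \in N ->
  fourier nu (k * g)%g x = nu k^-1%g * fourier nu g x.
Proof.
move=> Nk; rewrite mulr_sumr /fourier [LHS](reindex_inj (mulIg k^-1%g)) /=.
apply: eq_big => [n|n]; rewrite groupMr ?groupV // => Nn.
by rewrite mulgA mulgKV lcharM ?groupV //; ring.
Qed.

(** Orthogonality cancels the factor |N|^-1 of [e_nu]: the coefficient is zero unless [mu = nu] and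
    [h] lies in [N g], and is then a value of [nu]. *)
Lemma fourier_order_gen nu g : X (e_ nu * g_ g).
Proof.
move=> mu h; rewrite /fourier.
case Nhg: (h * g^-1 \in N)%g; last first.
  rewrite big1 // => n Nn; rewrite coeffMgelt coeff_char_idem lchar_out ?mulr0 ?mul0r //.
  by rewrite groupV -mulgA groupMl // Nhg.
rewrite (eq_bigr (fun n => (#|N|%:R^-1 * nu (h * g^-1)^-1%g) * (nu n^-1%g * mu n))).
  rewrite -mulr_sumr sum_group_lchar_mul mulrACA mulVf // mul1r.
  exact: RM.
move=> n Nn; rewrite coeffMgelt coeff_char_idem -mulgA invMg.
by rewrite lcharM ?groupV //; ring.
Qed.

Let reprP g : (g * (repr (coset N g))^-1)%g \in N.
Proof.
have NG x : x \in ('N(N))%g by have /subsetP-> := normal_norm normN; rewrite ?inE.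
apply: coset_idr => //; rewrite morphM ?morphV //= coset_reprK.
by rewrite mulgV.
Qed.

Let I : finType := (hatN * coset_of N)%type.
Let ex (i : I) : A := e_ i.1 * g_ (repr i.2).
Let fx (i : I) : A -> K := fourier i.1 (repr i.2).

Lemma fourier_orderE x : X x <-> forall i, R (fx i x).
Proof.
split=> [Xx i|Rf nu g]; first exact: Xx.
rewrite -[g](mulgKV (repr (coset N g))) fourier_mull ?reprP //.
by apply: RM => //; apply: (Rf (nu, coset N g)).
Qed.

(** Fourier inversion, carried out separately on each coset [N g], where [x] becomes a function on
    [N]. *)
Lemma fourier_frame x : x = \sum_i fx i x *: ex i.
Proof.
apply: galgP => y; rewrite coeff_sum.
rewrite -(pair_bigA _ (fun nu C => coeff (fx (nu, C) x *: ex (nu, C)) y)) /=.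
pose r := repr (coset N y).
transitivity (\sum_nu fourier nu r x * (#|N|%:R^-1 * nu (r * y^-1)%g)); last first.
  apply: eq_bigr => nu _; rewrite (big_only1 (coset N y)) // => [|C nC _].
    by rewrite coeffZ coeffMgelt coeff_char_idem invMg invgK.
  rewrite coeffZ coeffMgelt coeff_char_idem lchar_out ?mulr0 // groupV.
  apply: contra nC => NyC; rewrite -(coset_reprK C) eq_sym; apply/eqP.
  have NG z : z \in ('N(N))%g by have /subsetP-> := normal_norm normN; rewrite ?inE.
  by rewrite -[y in coset N y](mulgKV (repr C)) morphM //= coset_id // mul1g.
(* [k] is the position of [y] in its coset: summing [nu (n * k^-1)] over all [nu] selects
   [n = k]. *)
pose k := (y * r^-1)%g; have Nk : k \in N by apply: reprP.
have Nnk n : n \in N -> (n * k^-1)%g \in N by move=> Nn; rewrite groupM ?groupV.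
rewrite (eq_bigr (fun nu : hatN => \sum_(n in N)
  (#|N|%:R^-1 * coeff x (n * r)%g) * nu (n * k^-1)%g)).
  rewrite exchange_big /= (bigD1 k) //= [X in _ + X]big1 => [|n /andP[Nn nnk]].
    rewrite -mulr_sumr sum_lchar ?Nnk // mulgV eqxx mulr1 addr0.
    by rewrite mulrAC mulVf // mul1r mulgKV.
  rewrite -mulr_sumr sum_lchar ?Nnk // -eq_mulgV1 (negPf nnk).
  by rewrite !mulr0.
move=> nu _; rewrite mulr_suml; apply: eq_bigr => n Nn.
by rewrite (lcharM nu Nn) ?groupV // /k invMg invgK; ring.
Qed.

Let X0 : X 0.
Proof.
by apply/fourier_orderE => i; rewrite /fx /fourier big1 // => n _;
  rewrite coeff0 mul0r.
Qed.

Let XD x y : X x -> X y -> X (x + y).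
Proof.
by move=> Xx Xy nu g; rewrite -[x]scale1r fourier_is_linear mul1r; apply: RD.
Qed.

Let XZ a x : R a -> X x -> X (a *: x).
Proof.
move=> Ra Xx nu g; rewrite -[_ *: _]addr0 fourier_is_linear.
by apply: RD; [apply: RM | apply: X0].
Qed.

(** The span description of [X], which reduces each closure property to a single generator. *)
Lemma fourier_order_ind (P : A -> Prop) :
  P 0 -> (forall x y, P x -> P y -> P (x + y)) ->
  (forall a nu g, R a -> P (a *: (e_ nu * g_ g))) ->
  forall x, X x -> P x.
Proof.
move=> P0 PD Pg x Xx; rewrite [x]fourier_frame; apply: (big_ind P) => // i _.
by apply: Pg; apply: Xx.
Qed.

Lemma fourier_order_diag a : (forall nu : hatN, R (a nu)) -> X (diag a).
Proof.
move=> Ra; apply: (big_ind X) => // nu _; apply: XZ => //.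
by rewrite -[e_ nu]mulr1; apply: fourier_order_gen.
Qed.

Lemma char_idem_diag nu : e_ nu = diag (fun mu => (mu == nu)%:R).
Proof.
by rewrite /diag (big_only1 nu) ?eqxx ?scale1r // => mu /negPf -> _; rewrite scale0r.
Qed.

Lemma fourier_order_gelt g : X (g_ g).
Proof.
rewrite -[g_ g]mul1r -(diag1 nzN sepN) mulr_suml; apply: (big_ind X) => // nu _.
by rewrite scale1r; apply: fourier_order_gen.
Qed.

Lemma lchar_conj_subproof g (nu : hatN) : is_lchar N [ffun x => nu (x ^ g)%g].
Proof.
have NJ x : (x ^ g)%g \in N = (x \in N).
  by rewrite memJ_norm //; have /subsetP-> := normal_norm normN; rewrite ?inE.
apply/is_lcharP; split=> [x|x y Nx Ny]; rewrite !ffunE ?lchar_neq0 ?NJ //.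
by rewrite conjMg lcharM ?NJ.
Qed.
Definition lchar_conj g nu : hatN := LChar (lchar_conj_subproof g nu).

Lemma gelt_conj_char_idem g nu : g_ g * e_ nu = e_ (lchar_conj g nu) * g_ g.
Proof.
have mulgE (f : A) x : coeff (g_ g * f) x = coeff f (g^-1 * x)%g.
  rewrite coeffM (bigD1 g) //= big1 => [|y /negPf nyg].
    by rewrite coeff_gelt eqxx mul1r addr0.
  by rewrite coeff_gelt nyg mul0r.
apply: galgP => x; rewrite mulgE coeffMgelt !coeff_char_idem ffunE.
by rewrite conjVg conjgE !mulgA mulgKV.
Qed.

(** Moving [g] past [e_mu] replaces [mu] by a conjugate character, because [N] is normal. The
    product of [e_nu g] and [e_mu h] is thus zero or again a generator. *)
Lemma fourier_orderM x y : X x -> X y -> X (x * y).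
Proof.
move=> Xx; elim/fourier_order_ind => [|y1 y2 Xy1 Xy2|b mu h Rb].
- by rewrite mulr0.
- by rewrite mulrDr; apply: XD.
elim/fourier_order_ind: Xx => [|x1 x2 Xx1 Xx2|a nu g Ra].
- by rewrite mul0r.
- by rewrite mulrDl; apply: XD.
rewrite -scalerAl -scalerAr; apply: XZ => //; apply: XZ => //.
rewrite mulrA -[_ * g_ g * _]mulrA gelt_conj_char_idem mulrA char_idemM //.
rewrite -scalerAl -scalerAl -mulrA geltM.
by apply: XZ => //; apply: fourier_order_gen.
Qed.

(** The coproduct of [e_nu] is the sum of the [e_b ⊗ e_c] over [b c = nu], so it has no
    denominators, and [g] is grouplike. *)
Lemma fourier_order_coprod x : X x -> tens_sub X (D x).
Proof.
elim/fourier_order_ind => [|y y' Xy Xy'|a nu g Ra].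
- by rewrite -(scale0r 0) coprodZ scale0r; apply: tens_sub0.
- by rewrite coprodD; apply: tens_subD.
rewrite coprodZ coprodM coprod_gelt char_idem_diag coprod_diag // scalerAl.
apply: tens_subM; first exact: fourier_orderM; last first.
  by apply: tens_sub_pure; apply: fourier_order_gelt.
rewrite scaler_sumr; apply: tens_sub_sum => b; rewrite scaler_sumr.
apply: tens_sub_sum => c; rewrite scalerA -pureZl.
by apply: tens_sub_pure; rewrite -[e_ _]mulr1; [apply: XZ; first by apply: RM |];
  apply: fourier_order_gen.
Qed.

Lemma fourier_order_counit x : X x -> R (eps x).
Proof.
have epsZ a (f : A) : eps (a *: f) = a * eps f.
  by rewrite /= mulr_sumr; apply: eq_bigr => y _; rewrite coeffZ.
elim/fourier_order_ind => [|y y' Xy Xy'|a nu g Ra].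
- by rewrite -(scale0r 0) epsZ mul0r.
- have -> : eps (y + y') = eps y + eps y'; last exact: RD.
  by rewrite /= -big_split; apply: eq_bigr => z _; rewrite coeffD.
rewrite epsZ counitM; apply: RM => //; apply: RM; last first.
  by rewrite /= (big_only1 g) // => [|y /negPf n _]; rewrite coeff_gelt ?eqxx ?n.
(* The counit of [e_nu] is the average of [nu] over [N]. *)
suff -> : eps (e_ nu) = (nu == 1%g)%:R by [].
rewrite /= (eq_bigr (fun y => #|N|%:R^-1 * nu y^-1%g)) => [|y _]; last first.
  by rewrite coeff_char_idem.
rewrite -mulr_sumr (reindex_inj invg_inj) /= (bigID (fun y => y \in N)) /=.
rewrite [X in _ + X]big1 => [|y Ny]; last by rewrite invgK lchar_out.
rewrite addr0 (eq_bigr (fun y => nu y)) => [|y _]; last by rewrite invgK.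
by rewrite sum_group_lchar mulKf.
Qed.

Lemma fourier_order_antipode x : X x -> X (S x).
Proof.
elim/fourier_order_ind => [|y y' Xy Xy'|a nu g Ra].
- by rewrite -(scale0r 0) antipodeZ scale0r.
- by rewrite antipodeD; apply: XD.
rewrite antipodeZ antipodeM antipode_gelt char_idem_diag antipode_diag //.
apply: XZ => //; apply: fourier_orderM; first exact: fourier_order_gelt.
exact: fourier_order_diag.
Qed.

Lemma fourier_order_idem x :
  (forall y, y \notin N -> coeff x y = 0) -> x * x = x -> X x.
Proof.
move=> supp; pose a (nu : hatN) := \sum_(n in N) coeff x n * nu n.
have -> : x = diag a.
  rewrite [LHS]galg_sum (bigID (fun y => y \in N)) /= [X in _ + X]big1.
    rewrite addr0 big_mkcond.
    rewrite (eq_bigr (fun n => diag (fun nu : hatN =>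
        if n \in N then coeff x n * nu n else 0))).
      rewrite diag_sum; apply: eq_diag => nu; by rewrite -big_mkcond.
    move=> n _; case: ifP => Nn; first by rewrite (gelt_diag nzN sepN Nn) diagZ.
    by rewrite /diag big1 // => nu _; rewrite scale0r.
  by move=> y Ny; rewrite supp // scale0r.
rewrite diagM // => idem; apply: fourier_order_diag => nu.
have := diag_fourier nzN (fun phi => a phi * a phi) nu.
rewrite idem diag_fourier // => /esym/eqP.
rewrite -subr_eq0 -[X in _ - X]mulr1 -mulrBr mulf_eq0 subr_eq0.
by case/orP => /eqP ->.
Qed.

(** The frame of [X] is transported to [u X v]: generators [u (ex i) v], coordinates
    [fx i (v x u)]. *)
Lemma fourier_order_conj (u v : A) : u * v = 1 -> v * u = 1 ->
  let Y x := X (v * x * u) in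
  [/\ is_submodule R Y, fg_projective R Y & base_change_iso R Y].
Proof.
move=> uv vu Y; pose f i (x : A) := fx i (v * x * u).
pose e i := u * ex i * v.
have vev x : v * (u * x * v) * u = x by rewrite !mulrA vu mul1r -mulrA vu mulr1.
have uvu x : u * (v * x * u) * v = x by rewrite !mulrA uv mul1r -mulrA uv mulr1.
have f_lin i a x y : f i (a *: x + y) = a * f i x + f i y.
  by rewrite /f mulrDr mulrDl -scalerAr -scalerAl; apply: fourier_is_linear.
have YE x : Y x <-> forall i, R (f i x) by apply: fourier_orderE.
have Ye i : Y (e i) by rewrite /Y vev; apply: fourier_order_gen.
have fr x : x = \sum_i f i x *: e i.
  rewrite -[LHS]uvu [v * x * u]fourier_frame mulr_sumr mulr_suml.
  by apply: eq_bigr => i _; rewrite -scalerAr -scalerAl.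
split; [exact: frame_submodule YE|exact: frame_projective YE Ye fr|].
exact: frame_base_change YE Ye fr.
Qed.

End FourierOrder.

(** * The twist of a Lagrangian decomposition *)

Section Pairing.
Variables (K : fieldType) (T : finGroupType) (w : T -> T -> K).
Hypotheses (cocycle_w : normalized_cocycle w) (mulC : commutative (@mulg T)).

(** Three instances of the cocycle identity, for [(a, b, c)], [(b, c, a)] and [(b, a, c)].
    Commutativity makes [w b (a * c)] common to the last two, and it cancels in the quotient. *)
Lemma pairingMr a b c :
  pairing w a (b * c)%g = pairing w a b * pairing w a c.
Proof.
have [w0 wA _ _] := cocycle_w.
have e1 : w a (b * c)%g = w a b * w (a * b)%g c / w b c by rewrite wA mulfK.
have e2 : w (b * c)%g a = w b (a * c)%g * w c a / w b c.
  by rewrite (mulC a c) -wA mulrC mulKf.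
have e3 : w (a * b)%g c = w b (a * c)%g * w a c / w b a.
  by rewrite (mulC a b) -wA mulrC mulKf.
rewrite /pairing e1 e2 e3; field.
by rewrite !w0.
Qed.

Lemma pairingMl a b c :
  pairing w (a * b)%g c = pairing w a c * pairing w b c.
Proof.
have [w0 _ _ _] := cocycle_w.
have pV x y : pairing w x y = (pairing w y x)^-1.
  by rewrite /pairing invfM invrK mulrC.
by rewrite pV pairingMr invfM -!pV.
Qed.

Lemma pairing_neq0 a b : pairing w a b != 0.
Proof.
by have [w0 _ _ _] := cocycle_w; rewrite /pairing mulf_neq0 ?invr_eq0.
Qed.

End Pairing.

(** [lam] is the projection [pi] to [^L], and [ell phi] is what remains of [phi] after removing
    [s (lam phi)]. *)
Lemma lagrangian_coordinates (K : fieldType) (gT : finGroupType)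
    (M : {group gT}) (w : lchar K M -> lchar K M -> K)
    (L : {group lchar K M}) (s : lchar K L -> lchar K M) :
  normalized_cocycle w -> lagrangian_decomposition w s ->
  exists (lam : lchar K M -> lchar K L) (ell : lchar K M -> lchar K M),
  [/\ forall phi, ell phi \in L, forall phi, phi = (ell phi * s (lam phi))%g,
      {morph lam : a b / (a * b)%g}, {morph ell : a b / (a * b)%g}
    & forall l la, l \in L -> lam (l * s la)%g = la].
Proof.
move=> cocycle_w [lagr sM sL sB].
have mulC := @lchar_mulC K gT M.
have lamP phi : is_lchar L [ffun l => (if l \in L then pairing w phi l else 0) : K].
  apply/is_lcharP; split=> [l|l l' Ll Ll']; rewrite !ffunE.
    by case: (l \in L); rewrite ?pairing_neq0 ?eqxx.
  by rewrite groupM // Ll Ll' pairingMr.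
pose lam phi : lchar K L := LChar (lamP phi).
have lamE phi l : l \in L -> lam phi l = pairing w phi l.
  by move=> Ll; rewrite /= ffunE Ll.
have lamM : {morph lam : a b / (a * b)%g}.
  by move=> a b; apply: lchar_eq => l Ll; rewrite mul_lcharE !lamE // pairingMl.
have s1 : s 1%g = 1%g by apply: (mulgI (s 1%g)); rewrite -sM !mulg1.
have sV la : s la^-1%g = (s la)^-1%g.
  by apply: (mulgI (s la)); rewrite -sM !mulgV.
exists lam, (fun phi => phi * (s (lam phi))^-1)%g; split=> //.
(* The remainder pairs trivially with [L], hence lies in [L] because [L] is its own orthogonal. *)
- move=> phi; rewrite lagr inE; apply/forall_inP => l Ll.
  by rewrite pairingMl // -sV sL // inv_lcharE lamE // divff // pairing_neq0.
- by move=> phi; rewrite mulgKV.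
- by move=> a b /=; rewrite lamM sM (mulC (s _)) invMg !mulgA -(mulgA a) (mulC b)
    -!mulgA.
- move=> l la Ll; apply: lchar_eq => l' Ll'.
  (* Writing [l'] as [l' * s 1] brings the pairing to the form of [sB], whose second factor is then
     1. *)
  by rewrite lamE // -[X in pairing w _ X]mulg1 -s1 sB // one_lcharE Ll invr1 mulr1.
Qed.

Lemma tens_sub_conj (K : fieldType) (H : falgType K) (X : H -> Prop)
    (u v : H) (t : tens H H) :
  v * u = 1 -> tens_sub X t ->
  tens_sub (fun x => X (v * x * u)) (u ⊗ u * t * (v ⊗ v)).
Proof.
move=> vu [n [x [y [Xxy ->]]]].
have vuK z : v * (u * z * v) * u = z by rewrite !mulrA vu mul1r -mulrA vu mulr1.
rewrite mulr_sumr mulr_suml; apply: tens_sub_sum => i; rewrite !pure_mul.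
by case: (Xxy i) => Xx Xy; apply: tens_sub_pure; rewrite vuK.
Qed.

(** * Integrality of the standard twist and of the twisted structure maps *)

Section TwistedOrder.
Variables (K : fieldType) (R : K -> Prop) (gT : finGroupType).
Variables (M N : {group gT}) (w : lchar K M -> lchar K M -> K).
Variables (L : {group lchar K M}) (s : lchar K L -> lchar K M).
Hypotheses (R0 : R 0) (RD : forall a b, R a -> R b -> R (a + b)).
Hypotheses (RM : forall a b, R a -> R b -> R (a * b)).
Hypothesis Rroot : forall n z, (0 < n)%N -> z ^+ n = 1 -> R z.
Hypothesis nzK : forall n, (0 < n)%N -> n%:R != 0 :> K.
Hypotheses (sepM : separating K M) (sepN : separating K N).
Hypotheses (cocycle_w : normalized_cocycle w)
  (lagr : lagrangian_decomposition w s) (cohom_w : cohomologous_to_standard w s).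
Hypotheses (normN : (N <| [set: gT])%g) (LN : lagrangian_in_group s \subset N).
Local Notation A := (galg K gT).
Local Notation hatM := (lchar K M).
Local Notation hatL := (lchar K L).
Local Notation X := (@fourier_order K R gT N).

Let nzM : #|M|%:R != 0 :> K. Proof. exact/nzK/cardG_gt0. Qed.
Let nzN : #|N|%:R != 0 :> K. Proof. exact/nzK/cardG_gt0. Qed.
Let nzL : #|L|%:R != 0 :> K. Proof. exact/nzK/cardG_gt0. Qed.

Section Coordinates.
Variables (lam : hatM -> hatL) (ell : hatM -> hatM).
Hypotheses (ellL : forall phi, ell phi \in L).
Hypotheses (lamM : {morph lam : a b / (a * b)%g}).
Hypotheses (ellM : {morph ell : a b / (a * b)%g}).
Hypothesis lamE : forall l la, l \in L -> lam (l * s la)%g = la.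

(** This element is [e_la]. Its expansion in group elements has the denominator |L|, so membership
    comes from idempotence, and the expansion serves only to locate the support in [L], hence in
    [N]. *)
Lemma lagrangian_idem_order la : X (diag (fun phi => (lam phi == la)%:R)).
Proof.
apply: fourier_order_idem => // [y Ny|]; last first.
  by rewrite diagM //; apply: eq_diag => phi; rewrite -natrM mulnb andbb.
rewrite (@eq_diag _ _ _ _ (fun phi => \sum_(l in L)
    (#|L|%:R^-1 * la l^-1%g) * lam phi l)); last first.
  move=> phi; rewrite eq_sym -[LHS](mulKf nzL) -sum_group_lchar_mul mulr_sumr.
  by apply: eq_bigr => l _; rewrite mulrA.
rewrite (@eq_diag _ _ _ _ (fun phi => \sum_(l : hatM) if l \in L then
    (#|L|%:R^-1 * la l^-1%g) * lam phi l else 0)); last first.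
  by move=> phi; rewrite big_mkcond.
rewrite -diag_sum coeff_sum big1 // => l _; case Ll: (l \in L); last first.
  by rewrite coeff_diag big1 ?mulr0 // => phi _; rewrite mul0r.
rewrite -diagZ coeffZ.
have lam1 : lam 1%g = 1%g by apply: (mulgI (lam 1%g)); rewrite -lamM !mulg1.
(* By double duality this character of [^M] is evaluation at a point [m] of [M], namely [l] viewed
   in [M]. *)
have [||m Mm mE] := @diag_morph_gelt _ _ _ nzM sepM (fun phi => lam phi l).
- by move=> a b; rewrite lamM mul_lcharE.
- by rewrite lam1 one_lcharE Ll.
rewrite -(eq_diag mE) -gelt_diag // coeff_gelt.
case: eqP Ny => [->|]; rewrite ?mulr0 // => /negP[].
apply: (subsetP LN); rewrite inE Mm; apply/exists_inP; exists l => //.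
apply/forall_inP => l' Ll'; apply/forallP => mu.
by rewrite mE lamE.
Qed.

(** A character of [^M] is a group element, here [la] viewed in [M], and [X] contains all of [G]. *)
Lemma dual_lagrangian_order (la : hatL) : X (diag (fun phi => la (ell phi))).
Proof.
have ell1 : ell 1%g = 1%g by apply: (mulgI (ell 1%g)); rewrite -ellM !mulg1.
have [||m Mm mE] := @diag_morph_gelt _ _ _ nzM sepM (fun phi => la (ell phi)).
- by move=> a b; rewrite ellM lcharM.
- by rewrite ell1 lchar1.
by rewrite -(eq_diag mE) -gelt_diag //; apply: fourier_order_gelt.
Qed.

(* tau = id gives the standard twist and tau = inversion gives its inverse. *)
Lemma standard_twist_order (tau : hatL -> hatL) :
  tens_sub X (twist_of (fun a b => tau (lam a) (ell b))).
Proof.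
rewrite (@eq_twist_of _ _ _ _ (fun a b =>
    \sum_la (lam a == la)%:R * tau la (ell b))); last first.
  move=> a b; rewrite (big_only1 (lam a)) ?eqxx ?mul1r // => la /negPf n _.
  by rewrite eq_sym n mul0r.
rewrite -twist_of_sum; apply: tens_sub_sum => la; rewrite -diag_pure.
apply: tens_sub_pure; [exact: lagrangian_idem_order|exact: dual_lagrangian_order].
Qed.

(** The image of the tensor in [standard_twist_order] under multiplication: a sum of products
    [e_la * tau la]. *)
Lemma standard_antipode_order (tau : hatL -> hatL) :
  X (diag (fun a => tau (lam a) (ell a))).
Proof.
rewrite (@eq_diag _ _ _ _ (fun a =>
    \sum_la (lam a == la)%:R * tau la (ell a))); last first.
  move=> a; rewrite (big_only1 (lam a)) ?eqxx ?mul1r // => la /negPf n _.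
  by rewrite eq_sym n mul0r.
rewrite -diag_sum.
have X0 : X 0 by move=> nu g; rewrite /fourier big1 // => n _; rewrite coeff0 mul0r.
apply: (big_ind X) => // [x y Xx Xy nu g|la _].
  by rewrite -[x]scale1r fourier_is_linear mul1r; apply: RD.
rewrite -diagM //; apply: fourier_orderM => //.
  exact: lagrangian_idem_order.
exact: dual_lagrangian_order.
Qed.

End Coordinates.

Lemma twisted_hopf_order : admits_hopf_order R (twisted_galg w).
Proof.
have [lam [ell [ellL phiE lamM ellM lamE]]] :=
  lagrangian_coordinates cocycle_w lagr.
have [c c0 cE] := cohom_w.
have [w0 _ w1 _] := cocycle_w.
have wE a b : w a b = c a * c b * (c (a * b)%g)^-1 * lam a (ell b).
  by rewrite {1 2 3 4}[a]phiE {1 2 3}[b]phiE cE // -!phiE.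
have std0 a b : lam a (ell b) != 0 by rewrite lchar_neq0.
(* Normalization: the standard cocycle is 1 at [(1, 1)], so [w 1 1 = c 1]. This removes
   [c (a * a^-1)] from [U_J] below. *)
have c1 : c 1%g = 1.
  have := w1 1%g; rewrite wE mulg1.
  have -> : ell 1%g = 1%g by apply: (mulgI (ell 1%g)); rewrite -ellM !mulg1.
  by rewrite lchar1 mulr1 mulfK.
have ellV a : ell a^-1%g = (ell a)^-1%g.
  apply: (mulgI (ell a)); rewrite -ellM !mulgV.
  by apply: (mulgI (ell 1%g)); rewrite -ellM !mulg1.
pose u : galg K gT := diag c; pose v : galg K gT := diag (fun a => (c a)^-1).
have uv : u * v = 1.
  by rewrite diagM // -(diag1 nzM sepM); apply: eq_diag => a; rewrite divff.
have vu : v * u = 1.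
  by rewrite diagM // -(diag1 nzM sepM); apply: eq_diag => a; rewrite mulVf.
have uvK x : u * (v * x * u) * v = x by rewrite !mulrA uv mul1r -mulrA uv mulr1.
have [Ysub Yproj Ybase] := fourier_order_conj R0 RD RM Rroot nzN sepN normN uv vu.
exists (fun x => X (v * x * u)); split=> //.
- rewrite mulr1 vu; exact: fourier_order_gelt.
- move=> x y Xx Xy.
  have -> : v * (x * y) * u = (v * x * u) * (v * y * u).
    by rewrite !mulrA -(mulrA (v * x) u v) uv mulr1.
  exact: fourier_orderM.
- move=> x Xx; set y := v * x * u in Xx.
  pose J0 (tau : hatL -> hatL) : tens (galg K gT) (galg K gT) :=
    twist_of (fun a b : hatM => tau (lam a) (ell b)).
  (* The second factor is the coproduct of [u], so this reads [J Δ(u) = (u ⊗ u) J0]; [eV] is the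
     matching identity [Δ(v) J^-1 = J0^-1 (v ⊗ v)]. *)
  have eJ : twist_of w * twist_of (fun a b => c (a * b)%g) = u ⊗ u * J0 id.
    rewrite diag_pure !twist_ofM //; apply: eq_twist_of => a b.
    by rewrite wE mulrAC mulfVK.
  have eV : twist_of (fun a b => (c (a * b)%g)^-1) *
      twist_of (fun a b => (w a b)^-1) = J0 (@invg _) * (v ⊗ v).
    rewrite diag_pure !twist_ofM //; apply: eq_twist_of => a b.
    by rewrite wE inv_lcharE; field; rewrite !c0 std0.
  have -> : coprod (twisted_galg w) x =
      (u ⊗ u) * (J0 id * coprod (group_hopf K gT) y * J0 (@invg _)) * (v ⊗ v).
    (* Writing [x = u y v] puts the coproducts of [u] and [v] next to [J] and [J^-1], where [eJ] and
       [eV] absorb them. *)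
    transitivity (twist_of w * coprod (group_hopf K gT) (u * y * v) *
      twist_of (fun a b => (w a b)^-1)).
      by rewrite uvK -twist_of_inv.
    rewrite !coprodM !coprod_diag // !mulrA eJ -[LHS]mulrA eV.
    by rewrite !mulrA.
  apply: tens_sub_conj => //; have XM := fourier_orderM R0 RD RM Rroot nzN sepN normN.
  apply: tens_subM => //; first apply: tens_subM => //.
  + exact: standard_twist_order.
  + exact: fourier_order_coprod.
  + exact: standard_twist_order.
- move=> x Xx; have := fourier_order_counit R0 RD RM Rroot nzN sepN normN Xx.
  rewrite !counitM mulrAC -counitM vu.
  have -> : counit (group_hopf K gT) 1 = 1.
    rewrite /= (big_only1 1%g) // => [|y /negPf n _].
      by rewrite coeff_gelt eqxx.
    by rewrite coeff_gelt n.
  by rewrite mul1r.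
- move=> x Xx; set y := v * x * u in Xx.
  pose U0 (tau : hatL -> hatL) : galg K gT := diag (fun a : hatM => tau (lam a) (ell a)).
  have wV a : w a a^-1%g = c a * c a^-1%g * (lam a (ell a))^-1.
    by rewrite wE mulgV c1 invr1 mulr1 ellV lcharV.
  (* The antipode reverses products, so [S v] meets [U_J] on the left and [S u] meets its inverse on
     the right. Since [ell] inverts with [a], inversion now goes with [U_J] and the identity with
     its inverse. *)
  have eU : diag (fun a => w a a^-1%g) * diag (fun a => (c a^-1%g)^-1) =
      u * U0 (@invg _).
    rewrite !diagM //; apply: eq_diag => a; rewrite wV inv_lcharE.
    by field; rewrite !c0 std0.
  have eV : diag (fun a => c a^-1%g) * diag (fun a => (w a a^-1%g)^-1) =
      U0 id * v.
    rewrite !diagM //; apply: eq_diag => a; rewrite wV.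
    by field; rewrite !c0 std0.
  have -> : antipode (twisted_galg w) x =
      u * (U0 (@invg _) * antipode (group_hopf K gT) y * U0 id) * v.
    transitivity (diag (fun a => w a a^-1%g) *
      antipode (group_hopf K gT) (u * y * v) * diag (fun a => (w a a^-1%g)^-1)).
      by rewrite uvK -(diag_inv nzM sepM) // => a; apply: w0.
    rewrite !antipodeM !antipode_diag // !mulrA eU -[LHS]mulrA eV.
    by rewrite !mulrA.
  have vuK z : v * (u * z * v) * u = z.
    by rewrite !mulrA vu mul1r -mulrA vu mulr1.
  rewrite vuK; have XM := fourier_orderM R0 RD RM Rroot nzN sepN normN.
  apply: (XM _ _ _ _); first apply: (XM _ _ _ _).
  + exact: standard_antipode_order.
  + exact: fourier_order_antipode.
  + exact: standard_antipode_order.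
Qed.

End TwistedOrder.

Theorem theorem4p2 (K : fieldExtType rat) (gT : finGroupType)
    (M N : {group gT}) (w : lchar K M -> lchar K M -> K)
    (L : {group lchar K M}) (s : lchar K L -> lchar K M)
    (abM : abelian M) (centralM : central_type M)
    (splitM : split_algebra (galg K (subg_of M)))
    (splitN : split_algebra (galg K (subg_of N)))
    (cocycle_w : normalized_cocycle w) (nondeg_w : nondegenerate_cocycle w)
    (lagr : lagrangian_decomposition w s)
    (cohom_w : cohomologous_to_standard w s)
    (normN : (N <| [set: gT])%g) (abN : abelian N)
    (LN : lagrangian_in_group s \subset N) :
  admits_hopf_order (ring_of_integers K) (twisted_galg w).
Proof.
apply: (twisted_hopf_order _ _ _ _ _ _ _ cocycle_w lagr cohom_w normN LN).
- exact: integral0.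
- exact: integral_add.
- exact: integral_mul.
(* A root of unity is integral, being a root of the monic polynomial ['X^n - 1]. *)
- move=> n z n_gt0 zn; exists ('X^n - 1%:P); first exact: monicXnsubC.
  by rewrite /root rmorphB /= map_polyXn map_polyC /= !hornerE zn subrr.
- move=> n n_gt0; rewrite -(rmorph_nat (in_alg K)) fmorph_eq0.
  by rewrite Num.Theory.pnatr_eq0 -lt0n.
- exact: split_separating.
- exact: split_separating.
Qed.
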